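(* Let $K$ be an algebraically closed field of characteristic zero, let $X\subset\mathbb P^n=\mathbb P W$ be a hypersurface, and let $B$ be an irreducible component of the Fano scheme of lines $\mathbb F(X)$ with $\dim B\ge n-2$. Let $s_1\ge\dots\ge s_r\ge1$ be the integers attached to a general point of $B$ (see context), and let $x$ be a general point of $X_B$. If $\deg(X)\ge s_1+1$ and $s_1=n-1-\dim\mathcal C_x$, then for all $E\in B$, $\mathbb PE\cap X_{\mathrm{sing}}\neq\emptyset$.
   Context: $W$ is a $K$-vector space of dimension $n+1$, $\mathbb PW$ is the space of lines through $0$ in $W$, and $X=\{P=0\}$ with $P\in S^dW^*$, $d=\deg X$; $X_{\mathrm{sing}}$ is the set of singular points of $X$. $\mathbb F(X)\subset G(2,W)$ is the Fano scheme of lines on $X$. $\mathcal I_B=\{(x,E): E\in B,\ x\in\mathbb PE\}$, with projections $\pi$ to $X$ and $\rho$ to $B$; $X_B=\pi(\mathcal I_B)$, $\mathcal C_x=\rho\pi^{-1}(x)$ (the lines of $B$ through $x$). Normal form. $w\lrcorner P$ denotes contraction and $\circ$ the symmetric product. For $E\in B$ let $\sigma_{X,E}\colon E^*\otimes W/E\to S^dE^*$, $\alpha\otimes w\mapsto\alpha\circ(w\lrcorner P)|_E$ (well defined since $P|_E=0$); its kernel is the tangent space $T_E\mathbb F(X)$. Let $\Pi\subset W/E$ be the largest subspace with $E^*\otimes\Pi\subset\ker\sigma_{X,E}$, and $m=n-1-\dim\Pi$. Then $L=\ker\sigma_{X,E}/(E^*\otimes\Pi)\subset E^*\otimes((W/E)/\Pi)$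 contains no nonzero decomposable tensor, and for every basis $\alpha^1,\alpha^2$ of $E^*$ there are a basis $w_1,\dots,w_m$ of $(W/E)/\Pi$ and integers $s_1\ge\dots\ge s_r\ge1$, with $r=m-\dim L$ and $s_1+\dots+s_r=m$, such that, putting $t_k=s_1+\dots+s_{k-1}$, $L$ has basis $\alpha^1\otimes w_{t_k+i}-\alpha^2\otimes w_{t_k+i+1}$ ($1\le k\le r$, $1\le i\le s_k-1$). The $s_k$ are constant on a Zariski open dense subset of $B$; these are the integers used in the claim. *)

(* Defs.v *)
From HB Require Import structures.
From mathcomp Require Import all_boot all_algebra.
From mathcomp Require Export mpoly.

Set Implicit Arguments.
Unset Strict Implicit.
Unset Printing Implicit Defensive.

Import GRing.Theory.
Local Open Scope ring_scope.

(* The topology of [T] is given by its family [closed] of closed sets; subsets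
   of [T] carry the induced topology. *)
Section ZariskiTopology.
Variables (T : Type) (closed : (T -> Prop) -> Prop).
Implicit Types A B Z Q : T -> Prop.

Definition sub A B := forall t, A t -> B t.

Definition dense_in A B := sub A B /\ forall Z, closed Z -> sub A Z -> sub B Z.

(* [Q] holds at the points of an open dense subset of [A], namely of the
   trace on [A] of the complement of [Z]. *)
Definition generically A Q :=
  exists Z, [/\ closed Z, dense_in (fun t => A t /\ ~ Z t) A
              & forall t, A t -> ~ Z t -> Q t].

Definition irreducible Z :=
  (exists t, Z t) /\
  forall Z1 Z2, closed Z1 -> closed Z2 ->
    sub Z (fun t => Z1 t \/ Z2 t) -> sub Z Z1 \/ sub Z Z2.

Definition irreducible_closed Z := closed Z /\ irreducible Z.

(* The irreducible components of a closed set [A]. *)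
Definition irreducible_component A B :=
  [/\ irreducible_closed B, sub B A
    & forall Z, irreducible_closed Z -> sub Z A -> sub B Z -> sub Z B].

Definition has_chain A k :=
  exists Z : nat -> T -> Prop,
    (forall i, (i <= k)%N -> irreducible_closed (Z i) /\ sub (Z i) A) /\
    (forall i, (i < k)%N -> sub (Z i) (Z i.+1) /\ ~ sub (Z i.+1) (Z i)).

(* The Krull dimension of a closed set [A] is [k]. *)
Definition has_dim A k := has_chain A k /\ ~ has_chain A k.+1.

End ZariskiTopology.

(* [t] of [U] descends to a basis of the quotient [V / U]. *)
Definition quotient_basis (K : fieldType) (vT : vectType K)
    (U V : {vspace vT}) (t : seq vT) :=
  (U <= V)%VS && basis_of V (vbasis U ++ t).

(* Projective geometry of W = K^(n+1). *)
Section Fano.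
Variables (K : fieldType) (n : nat).
Local Notation W := 'rV[K]_n.+1.

Definition Gr (k : nat) := {E : {vspace W} | \dim E == k}.

Definition zero_locus (T : Type) (N : nat) (c : T -> 'rV[K]_N)
    (S : {mpoly K[N]} -> Prop) (t : T) :=
  forall f, S f -> f.@[c t 0] = 0.

(* [c t] are homogeneous coordinates of [t], determined up to a scalar. *)
Definition zariski_closed (T : Type) (N : nat) (c : T -> 'rV[K]_N)
    (Z : T -> Prop) :=
  exists2 S : {mpoly K[N]} -> Prop,
    (forall f, S f -> exists d, f \is d.-homog) &
    (forall t, Z t <-> zero_locus c S t).

Definition proj_coord (x : Gr 1) : W := vpick (sval x).

(* Pluecker coordinates u_i v_j - u_j v_i, for a basis (u, v) of [E]. *)
Definition pluecker (E : Gr 2) : 'rV[K]_(n.+1 * n.+1) :=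
  let u := (vbasis (sval E))`_0 in
  let v := (vbasis (sval E))`_1 in
  mxvec (u^T *m v - v^T *m u).

Definition closedP : (Gr 1 -> Prop) -> Prop := zariski_closed proj_coord.
Definition closedG : (Gr 2 -> Prop) -> Prop := zariski_closed pluecker.

Section Hypersurface.
Variable P : {mpoly K[n.+1]}.

Definition singular (x : Gr 1) :=
  forall v : W, v \in sval x ->
    P.@[v 0] = 0 /\ forall i, P^`M(i).@[v 0] = 0.

Definition fano (E : Gr 2) := forall v : W, v \in sval E -> P.@[v 0] = 0.

(* w _| P, normalised as the derivative of [P] in the direction [w]. *)
Definition contract (w : W) : {mpoly K[n.+1]} :=
  \sum_(i < n.+1) w 0 i *: P^`M(i).

Section Sigma.
Variable E : {vspace W}.

(* The tensor product of the dual of [E] with W is taken to be Hom(E, W). *)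
Definition dual := 'Hom(subvs_of E, K^o).
Definition tensors := 'Hom(subvs_of E, W).

Definition tensor (a : dual) (w : W) : tensors :=
  linfun (fun v : subvs_of E => (a v : K) *: w).

Definition dual_tensor (U : {vspace W}) : {vspace tensors} :=
  <<[seq tensor a w | a <- vbasis {: dual}, w <- vbasis U]>>%VS.

(* The linear map with alpha (x) w |-> alpha o (w _| P)|_E, see [sigma_tensor].
   Elements of S^d E^* are viewed as polynomial functions on [E], which is
   faithful over an infinite field; their symmetric product is then pointwise.
   Quotients of W by [E] are handled upstairs in W: when P|_E = 0, the map
   kills Hom(E, E). *)
Definition sigma (phi : tensors) (v : subvs_of E) : K :=
  (contract (phi v)).@[(vsval v) 0].

Lemma tensorE (a : dual) w v : tensor a w v = (a v : K) *: w.
Proof.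
have lin : linear (fun v : subvs_of E => (a v : K) *: w).
  by move=> c x y; rewrite linearP scalerDl scalerA.
pose f : {linear subvs_of E -> W} := HB.pack
  (fun v : subvs_of E => (a v : K) *: w) (GRing.isLinear.Build _ _ _ _ _ lin).
exact: (lfunE f v).
Qed.

Lemma sigma_tensor (a : dual) w v :
  sigma (tensor a w) v = a v * (contract w).@[(vsval v) 0].
Proof.
rewrite /sigma tensorE /contract !raddf_sum mulr_sumr.
by apply: eq_bigr => i _; rewrite mxE /= !mevalZ mulrA.
Qed.

Lemma sigmaD (phi psi : tensors) v :
  sigma (phi + psi) v = sigma phi v + sigma psi v.
Proof.
rewrite /sigma /contract !raddf_sum -big_split; apply: eq_bigr => i _.
by rewrite /= add_lfunE mxE !mevalZ mulrDl.
Qed.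

Lemma sigmaZ c (phi : tensors) v : sigma (c *: phi) v = c * sigma phi v.
Proof.
rewrite /sigma /contract !raddf_sum mulr_sumr; apply: eq_bigr => i _.
by rewrite /= scale_lfunE mxE !mevalZ mulrA.
Qed.

Definition is_ker_sigma (N : {vspace tensors}) :=
  forall phi, phi \in N <-> forall v, sigma phi v = 0.

(* [Pi] is the preimage in W of the subspace called Pi of W / E. *)
Definition is_Pi (N : {vspace tensors}) (Pi : {vspace W}) :=
  [/\ (E <= Pi)%VS, (dual_tensor Pi <= N)%VS
    & forall U : {vspace W},
        (E <= U)%VS -> (dual_tensor U <= N)%VS -> (U <= Pi)%VS].

(* Indices start at 0, for the blocks as well as inside each block. *)
Definition kronecker (a1 a2 : dual) (w : seq W) (s : seq nat) : seq tensors :=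
  [seq tensor a1 w`_(sumn (take k s) + i)
         - tensor a2 w`_(sumn (take k s) + i.+1)
     | k <- iota 0 (size s), i <- iota 0 (nth 0%N s k).-1].

(* Here m is the dimension of (W / E) / Pi, and the dimension of
   L = N / dual_tensor Pi is the difference of dimensions appearing below. *)
Definition normal_form (s : seq nat) :=
  exists (N : {vspace tensors}) (Pi : {vspace W}),
    [/\ is_ker_sigma N, is_Pi N Pi &
        let m := (n.+1 - \dim Pi)%N in
        [/\ sorted geq s && all (leq 1) s,
            sumn s = m,
            size s = (m - (\dim N - \dim (dual_tensor Pi)))%N
          & forall a1 a2 : dual, basis_of {: dual} [:: a1; a2] ->
              exists w : seq W,
                quotient_basis Pi fullv w /\
                quotient_basis (dual_tensor Pi) N (kronecker a1 a2 w s)]].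

End Sigma.
End Hypersurface.

Section Family.
Variable B : Gr 2 -> Prop.

Definition incidence (x : Gr 1) (E : Gr 2) := B E /\ (sval x <= sval E)%VS.

Definition swept (x : Gr 1) := exists E, incidence x E.

Definition lines_through (x : Gr 1) (E : Gr 2) := incidence x E.

End Family.
End Fano.

(* Main.v *)
Require Import Defs.
From HB Require Import structures.
From mathcomp Require Import all_boot all_algebra.
From mathcomp Require Import boolp classical_sets.
From mathcomp Require Import ring.
Set Implicit Arguments.
Unset Strict Implicit.
Unset Printing Implicit Defensive.
Import GRing.Theory.
Local Open Scope ring_scope.

(* Pi_E = {w | w _| P = 0 on E} satisfies c <= dim Pi_E / E for every E in B. Indeed, in the
   function field of the variety of pairs (u, v) of vectors of a line of B, derivations
   that kill u map v to vectors w with w _| P = 0 on the generic line, by differentiating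
   P(a u + v) = 0; in characteristic 0, the transcendence degree of the coordinates of v
   over K(u) is therefore at most the generic value of dim Pi_E, hence at most any of its
   values. So any c + 2 coordinates of v would be algebraically dependent over K(u) if
   dim Pi_E < c + 2, and specializing the relations at a general point x contradicts the
   existence of a chain of c + 1 irreducible closed subsets of C_x.

   Hence m <= n - 1 - c = s_1 at a general E, so there is at most one block, and the
   restrictions to E of the w_i _| P are X^i Y^(m-1-i) phi with deg phi = d - m > 0: a zero
   of phi is a singular point of X. That E avoids X_sing is an open condition, by a
   resultant, so that it cannot hold anywhere on B. *)

(** Dimension is given by chains of irreducible closed sets, so it enters the proof only through
    algebraic independence. Above a chain of [c + 1] families of lines through [x] stand their
    affine cones, all containing the line of [x]; put [0] and that line in front, and the [c + 3]
    members of the chain of primes yield [c + 2] independent functions. This is the origin of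
    [c + 2]. The vector [u] stays a parameter because the relations have to survive at a fixed
    point: their coefficients are polynomials in [u], and one of them is not identically zero. Which
    coordinates are independent on the cone depends on the point, so relations are prepared for
    every choice of coordinates before the point is chosen. Pairs of vectors replace lines because
    they live in an affine space, where the ideal of the family is prime: [B] is irreducible and the
    pairs in a given [E] form a vector space. The condition on [w _| P] is written as the kernel of
    one finite matrix, so that the generic rank and the rank at a given line are compared by a
    single determinant. *)

Definition prime_ideal (R : comNzRingType) (I : R -> Prop) :=
  [/\ I 0, forall f g, I f -> I g -> I (f + g), forall f g, I g -> I (f * g),
      ~ I 1 & forall f g, I (f * g) -> I f \/ I g].

(** * Function fields of prime ideals *)

Section PrimeQuotient.
Local Open Scope quotient_scope.
Variables (R : comNzRingType) (I : R -> Prop) (prI : prime_ideal I).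

Let mem_I : {pred R} := fun f => `[< I f >].

Let mem_I_closed : idealr_closed mem_I.
Proof.
have [I0 ID IM I1 _] := prI; split.
- by rewrite unfold_in; apply/asboolP.
- by rewrite unfold_in; apply/asboolP.
- move=> a u v; rewrite !unfold_in => /asboolP Iu /asboolP Iv; apply/asboolP.
  by apply: ID => //; apply: IM.
Qed.

Let mem_I_prime : prime_idealr_closed mem_I.
Proof.
case: prI => _ _ _ _ IP u v; rewrite !unfold_in => /asboolP/IP[] h.
  by apply/orP; left; apply/asboolP.
by apply/orP; right; apply/asboolP.
Qed.

HB.instance Definition _ := isIdealr.Build R mem_I mem_I_closed.
HB.instance Definition _ := isPrimeIdealrClosed.Build R mem_I mem_I_prime.

Let Q : Type := {ideal_quot mem_I}.
HB.instance Definition _ := GRing.ComNzRing.on Q.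

(** Fractions are formed over an integral domain with a partial inverse; units and inverses are
    therefore picked classically. *)
Let has_inv (x : Q) := `[< exists y, y * x = 1 >].
Let inv_quot (x : Q) : Q := xget x [set y | y * x = 1]%classic.

Let mulV_quot : {in has_inv, left_inverse 1 inv_quot *%R}.
Proof.
by move=> x; rewrite unfold_in => /asboolP /(xgetPex x).
Qed.

Let inv_quotP (x y : Q) : y * x = 1 -> has_inv x.
Proof. by move=> yx; apply/asboolP; exists y. Qed.

Let inv_quot_out : {in [predC has_inv], inv_quot =1 id}.
Proof.
move=> x; rewrite !unfold_in => /asboolP nx.
by rewrite /inv_quot xgetPN // => y yx; apply: nx; exists y.
Qed.

HB.instance Definition _ := GRing.ComNzRing_hasMulInverse.Build Q
  mulV_quot inv_quotP inv_quot_out.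
HB.instance Definition _ := GRing.ComUnitRing_isIntegral.Build Q
  (@Quotient.rquot_IdomainAxiom _ mem_I).

Lemma prime_ideal_kernel :
  exists (L : fieldType) (phi : {rmorphism R -> L}), forall f, phi f = 0 <-> I f.
Proof.
exists {fraction Q}.
exists ((@tofrac Q) \o (\pi_({ideal_quot mem_I})) : {rmorphism R -> {fraction Q}}).
move=> f; have -> : (I f) = (f \in mem_I) by rewrite unfold_in asboolE.
rewrite -[f in f \in _]subr0 Quotient.idealrBE /=.
have -> : (f == 0 %[mod {ideal_quot mem_I}]) = (tofrac (\pi_({ideal_quot mem_I}) f : Q) == 0).
  by rewrite tofrac_eq0 rmorph0.
by split=> [/eqP|/eqP].
Qed.
End PrimeQuotient.

(** * Derivations *)

Section Derivations.
Variable L : fieldType.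

(** The domain is a mere subring [S], so that a derivation can be enlarged one element at a time
    without passing to fields of fractions. *)
Definition derivation_on (S : L -> Prop) (D : L -> L) :=
  [/\ S 1, forall a b, S a -> S b -> S (a - b),
      forall a b, S a -> S b -> S (a * b),
      forall a b, S a -> S b -> D (a + b) = D a + D b
    & forall a b, S a -> S b -> D (a * b) = D a * b + a * D b].

Section Adjoin.
Variables (S : L -> Prop) (D : L -> L) (derD : derivation_on S D).

Lemma der_ring0 : S 0.
Proof. by have [S1 SB _ _ _] := derD; rewrite -(subrr 1); apply: SB. Qed.

Lemma der_ringD a b : S a -> S b -> S (a + b).
Proof.
have [S1 SB _ _ _] := derD => Sa Sb; rewrite -[b]opprK; apply: (SB) => //.
by rewrite -sub0r; apply: SB => //; apply: der_ring0.
Qed.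

Lemma der_ring_sum k (F : 'I_k -> L) : (forall i, S (F i)) -> S (\sum_i F i).
Proof. by move=> SF; elim/big_ind: _ => //; [apply: der_ring0|apply: der_ringD]. Qed.

Lemma der_ring_nat k : S k%:R.
Proof.
elim: k => [|k IH]; first exact: der_ring0.
by rewrite -natr1; apply: der_ringD => //; have [] := derD.
Qed.

Lemma der0 : D 0 = 0.
Proof.
have [_ _ _ DD _] := derD; apply: (addrI (D 0)).
by rewrite -DD ?addr0 //; apply: der_ring0.
Qed.

Lemma der_sum k (F : 'I_k -> L) :
  (forall i, S (F i)) -> D (\sum_i F i) = \sum_i D (F i).
Proof.
have [_ _ _ DD _] := derD.
elim: k F => [|k IH] F SF; first by rewrite !big_ord0 der0.
by rewrite !big_ord_recl DD ?IH //; apply: der_ring_sum.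
Qed.

Definition coefs_in (q : {poly L}) := forall i, S q`_i.
Definition der_coefs (q : {poly L}) := \poly_(i < size q) D q`_i.

Lemma coef_der_coefs q i : (der_coefs q)`_i = D q`_i.
Proof. by rewrite coef_poly; case: ltnP => // /(nth_default 0) ->; rewrite der0. Qed.

Lemma coefs_inD q r : coefs_in q -> coefs_in r -> coefs_in (q + r).
Proof. by move=> Sq Sr i; rewrite coefD; apply: der_ringD. Qed.

Lemma coefs_inM q r : coefs_in q -> coefs_in r -> coefs_in (q * r).
Proof.
move=> Sq Sr i; rewrite coefM; apply: der_ring_sum => j.
by have [_ _ SM _ _] := derD; apply: SM.
Qed.

Lemma coefs_inC a : S a -> coefs_in a%:P.
Proof. by move=> Sa i; rewrite coefC; case: ifP => // _; apply: der_ring0. Qed.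

Lemma coefs_inX k : coefs_in 'X^k.
Proof. by move=> i; rewrite coefXn; apply: der_ring_nat. Qed.

Lemma coefs_inB q r : coefs_in q -> coefs_in r -> coefs_in (q - r).
Proof. by move=> Sq Sr i; rewrite coefB; have [_ SB _ _ _] := derD; apply: SB. Qed.

Lemma coefs_in_deriv q : coefs_in q -> coefs_in q^`().
Proof.
move=> Sq i; rewrite coef_deriv -mulr_natr.
by have [_ _ SM _ _] := derD; apply: SM => //; apply: der_ring_nat.
Qed.

Lemma der_coefsD q r : coefs_in q -> coefs_in r ->
  der_coefs (q + r) = der_coefs q + der_coefs r.
Proof.
move=> Sq Sr; apply/polyP => i; rewrite coefD !coef_der_coefs coefD.
by have [_ _ _ DD _] := derD; apply: DD.
Qed.

Lemma der_coefsM q r : coefs_in q -> coefs_in r ->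
  der_coefs (q * r) = der_coefs q * r + q * der_coefs r.
Proof.
have [_ _ SM _ DM] := derD.
move=> Sq Sr; apply/polyP => i; rewrite coefD !coef_der_coefs !coefM.
rewrite der_sum => [|j]; last exact: SM.
rewrite -big_split /=; apply: eq_bigr => j _.
by rewrite DM // !coef_der_coefs.
Qed.

Section Value.
Variable x : L.

(* The value at [q.[x]] of the extension of [D] that sends [x] to [c]. *)
Definition der_value c (q : {poly L}) := (der_coefs q).[x] + q^`().[x] * c.

Lemma der_valueD c q r : coefs_in q -> coefs_in r ->
  der_value c (q + r) = der_value c q + der_value c r.
Proof.
by move=> Sq Sr; rewrite /der_value der_coefsD // derivD !hornerD mulrDl addrACA.
Qed.

Lemma der_valueM c q r : coefs_in q -> coefs_in r ->
  der_value c (q * r) = der_value c q * r.[x] + q.[x] * der_value c r.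
Proof.
move=> Sq Sr; rewrite /der_value der_coefsM // derivM !(hornerD, hornerM).
rewrite !mulrDl !mulrDr addrACA; congr (_ + _ + _); first by rewrite mulrAC.
by rewrite mulrA.
Qed.

Hypothesis charL : [pchar L] =i pred0.

(** If [x] satisfies no nonzero relation over [S], any [c] will do. Otherwise [c] is forced by
    [der_value c m = 0] for a nonzero relation [m] of least degree, and every other relation reduces
    to [m] by division. *)
Lemma der_value_kernel :
  exists c, forall q, coefs_in q -> q.[x] = 0 -> der_value c q = 0.
Proof.
have [_ SB SM _ _] := derD.
pose Q k := `[< exists q, [/\ coefs_in q, q != 0, q.[x] = 0 & size q = k] >].
case: (pselect (exists k, Q k)) => [exQ|nQ]; last first.
  exists 0 => q Sq qx; rewrite (_ : q = 0).
    by rewrite /der_value linear0 !horner0 mul0r addr0 /der_coefs size_poly0 poly_def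
         big_ord0 horner0.
  apply/eqP; apply: contrapT => /negP q0; apply: nQ; exists (size q).
  by apply/asboolP; exists q.
case: (ex_minnP exQ) => k /asboolP[m [Sm m0 mx <-]] min_m.
have {}min_m q : coefs_in q -> q.[x] = 0 -> (size q < size m)%N -> q = 0.
  move=> Sq qx; rewrite ltnNge => /negP lt; apply/eqP; apply: contrapT => /negP q0.
  by apply: lt; apply: min_m; apply/asboolP; exists q.
(* Otherwise the derivative would be a shorter relation, hence zero, and [m] would be constant in
   characteristic zero. *)
have m'x : m^`().[x] != 0.
  apply/eqP => m'x; have m'0 : m^`() = 0.
    by apply: min_m => //; [apply: coefs_in_deriv|apply: lt_size_deriv].
  have sm : (size m <= 1)%N.
    apply/leq_sizeP => -[//|j] _; apply/eqP.
    have /eqP := congr1 (fun p : {poly L} => p`_j) m'0.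
    rewrite coef_deriv coef0 -mulr_natr mulf_eq0.
    by rewrite ((pcharf0P L).1 charL) orbF.
  move: mx m0; rewrite (size1_polyC sm) hornerC => ->.
  by rewrite eqxx.
exists (- (der_coefs m).[x] / m^`().[x]); set c := _ / _ => q.
have vm : der_value c m = 0.
  by rewrite /der_value /c mulrCA mulfV // mulr1 subrr.
have [s] := ubnP (size q); elim: s q => // s IH q ltqs Sq qx.
have [lt_qm|le_mq] := ltnP (size q) (size m).
  rewrite (min_m q) // /der_value linear0 !horner0 mul0r addr0.
  by rewrite /der_coefs size_poly0 poly_def big_ord0 horner0.
have [->|q0] := eqVneq q 0.
  rewrite /der_value linear0 !horner0 mul0r addr0.
  by rewrite /der_coefs size_poly0 poly_def big_ord0 horner0.
(* Pseudo-division, since [S] need not be a field: the factor [lead_coef m] keeps the coefficients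
   in [S] and is cancelled at the end. *)
pose e := (size q - size m)%N.
pose a := (lead_coef m)%:P; pose b := (lead_coef q)%:P * 'X^e.
have Sa : coefs_in a by apply: coefs_inC; apply: Sm.
have Sb : coefs_in b.
  by apply: coefs_inM; [apply: coefs_inC; apply: Sq|apply: coefs_inX].
have sm0 : (0 < size m)%N by rewrite size_poly_gt0.
have sq0 : (0 < size q)%N by rewrite size_poly_gt0.
have szr : (size (a * q - b * m)%R < size q)%N.
  rewrite -[in X in (_ < X)%N](prednK sq0) ltnS; apply/leq_sizeP => j le_j.
  rewrite coefB coefCM -mulrA coefCM mulrC coefXnM.
  have -> : (j < e)%N = false.
    by apply/negbTE; rewrite -leqNgt (leq_trans _ le_j) // /e -subn1 leq_sub2l.
  move: le_j; rewrite leq_eqVlt => /predU1P[<-|lt_j].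
    have -> : ((size q).-1 - e)%N = (size m).-1.
      by rewrite /e -!subn1 subnAC subKn.
    by rewrite -!lead_coefE subrr.
  rewrite [q`_j]nth_default ?mul0r; last by rewrite -(prednK sq0).
  rewrite [m`_(_)]nth_default ?mulr0 ?subrr //.
  rewrite leq_subRL; last by apply: leq_trans (ltnW lt_j); rewrite /e -subn1 leq_sub2l.
  by rewrite /e subnK // -(prednK sq0).
have Sr : coefs_in (a * q - b * m) by apply: coefs_inB; apply: coefs_inM.
have := IH _ (leq_trans szr ltqs) Sr.
rewrite hornerD hornerN !hornerM qx mx !mulr0 subr0 => /(_ erefl) v0.
have : der_value c (a * q - b * m + b * m) = 0.
  rewrite der_valueD //; last exact: coefs_inM.
  by rewrite v0 add0r der_valueM // vm mx !mulr0 addr0.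
rewrite subrK der_valueM // qx mulr0 add0r /a hornerC => /eqP.
by rewrite mulf_eq0 lead_coef_eq0 (negbTE m0) => /eqP.
Qed.

(** Elements of [S[x]] are values at [x] of polynomials over [S]; by the choice of [c] the
    derivative does not depend on the polynomial. *)
Lemma derivation_adjoin :
  exists S' D', [/\ derivation_on S' D', forall a, S a -> S' a /\ D' a = D a & S' x].
Proof.
have [S1 SB SM DD DM] := derD.
have [c vc] := der_value_kernel.
pose S' a := exists q, coefs_in q /\ q.[x] = a.
pose D' a := der_value c (xget 0 [set q | coefs_in q /\ q.[x] = a]%classic).
have D'E q : coefs_in q -> D' q.[x] = der_value c q.
  move=> Sq; rewrite /D'.
  have [] := @xgetPex _ 0 [set r | coefs_in r /\ r.[x] = q.[x]]%classic; first by exists q.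
  set r := xget _ _ => Sr rx; rewrite -[r](subrK q).
  have Srq := coefs_inB Sr Sq.
  by rewrite der_valueD // vc ?add0r // hornerD hornerN rx subrr.
exists S', D'; split; last by exists 'X; rewrite hornerX -['X]expr1; split=> //; apply: coefs_inX.
- split.
  + by exists 1; rewrite hornerC; split=> //; apply: coefs_inC.
  + move=> _ _ [q [Sq <-]] [r [Sr <-]]; exists (q - r).
    by rewrite hornerD hornerN; split=> //; apply: coefs_inB.
  + move=> _ _ [q [Sq <-]] [r [Sr <-]]; exists (q * r).
    by rewrite hornerM; split=> //; apply: coefs_inM.
  + move=> _ _ [q [Sq <-]] [r [Sr <-]]; rewrite -hornerD !D'E ?der_valueD //.
    exact: coefs_inD.
  + move=> _ _ [q [Sq <-]] [r [Sr <-]]; rewrite -hornerM !D'E ?der_valueM //.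
    exact: coefs_inM.
- move=> a Sa; split; first by exists a%:P; rewrite hornerC; split=> //; apply: coefs_inC.
  rewrite -[in LHS](hornerC a x) D'E; last exact: coefs_inC.
  rewrite /der_value derivC horner0 mul0r addr0.
  rewrite (_ : der_coefs _ = (D a)%:P) ?hornerC //.
  apply/polyP => i; rewrite coef_der_coefs !coefC.
  by case: ifP => // _; apply: der0.
Qed.
End Value.
End Adjoin.

Lemma derivation_extension S D (xs : seq L) : [pchar L] =i pred0 ->
  derivation_on S D ->
  exists S' D', [/\ derivation_on S' D', forall a, S a -> S' a /\ D' a = D a
    & forall x, x \in xs -> S' x].
Proof.
move=> charL; elim: xs S D => [|x xs IH] S D dD.
  by exists S, D; split.
have [S1 [D1 [d1 e1 S1x]]] := derivation_adjoin dD x charL.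
have [S2 [D2 [d2 e2 S2x]]] := IH _ _ d1.
exists S2, D2; split=> //.
- by move=> a Sa; have [S1a D1a] := e1 _ Sa; have [S2a D2a] := e2 _ S1a; rewrite D2a.
- by move=> y; rewrite in_cons => /predU1P[->|/S2x //]; have [] := e2 _ S1x.
Qed.
End Derivations.

(** * Algebraic independence *)

Lemma mpoly_ring_ind (R : comNzRingType) n (Q : {mpoly R[n]} -> Prop) :
    (forall c, Q c%:MP) -> (forall i, Q 'X_i) ->
    (forall f g, Q f -> Q g -> Q (f + g)) ->
    (forall f g, Q f -> Q g -> Q (f * g)) -> forall f, Q f.
Proof.
move=> QC QX QD QM f; elim/mpolyind: f => [|c m f _ _ Qf].
  by rewrite -mpolyC0; apply: QC.
suff: Q (c *: 'X_[m]) by move=> Qm; apply: (QD _ _ Qm).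
rewrite -mul_mpolyC; apply: (QM _ _ (QC c)).
rewrite mpolyXE_id; apply: (big_ind Q) => //; first by rewrite -mpolyC1; apply: QC.
move=> i _; elim: (m i) => [|k IH]; first by rewrite expr0 -mpolyC1; apply: QC.
by rewrite exprS; apply: (QM _ _ (QX i)).
Qed.

Lemma mderivXU (R : comNzRingType) n (i j : 'I_n) :
  ('X_i : {mpoly R[n]})^`M(j) = (i == j)%:R.
Proof.
rewrite mderivX mnm1E; have [->|_] := eqVneq i j; last by rewrite scale0r.
rewrite scale1r (_ : (_ - _)%MM = 0%MM) ?mpolyX0 //.
by apply/mnmP => l; rewrite mnmBE mnm0E subnn.
Qed.

Section AlgebraicIndependence.
Variables (R : comNzRingType) (L : fieldType) (iota : {rmorphism R -> L}).

(** [iota] need not be injective: [R] may be a polynomial ring in coordinates that satisfy relations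
    in [L]. A relation is therefore trivial once its coefficients vanish in [L]. *)
Definition alg_indep k (y : 'I_k -> L) :=
  forall G : {mpoly R[k]}, mmap iota y G = 0 -> forall m, iota G@_m = 0.

Lemma mmap_coeff0 k (y : 'I_k -> L) (G : {mpoly R[k]}) :
  (forall m, iota G@_m = 0) -> mmap iota y G = 0.
Proof. by move=> G0; rewrite /mmap big1 // => m _; rewrite G0 mul0r. Qed.

Lemma mmapXU (S : comNzRingType) k (f : {rmorphism R -> S}) (y : 'I_k -> S) i :
  mmap f y 'X_i = y i.
Proof. by rewrite mmapX mmap1U. Qed.

Lemma chain_rule S D k (x : 'I_k -> L) : derivation_on S D ->
    (forall r, S (iota r) /\ D (iota r) = 0) -> (forall j, S (x j)) ->
  forall f, S (mmap iota x f) /\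
    D (mmap iota x f) = \sum_j mmap iota x f^`M(j) * D (x j).
Proof.
move=> derD Siota Sx f; have [S1 SB SM DD DM] := derD.
elim/mpoly_ring_ind: f => [c|i|f g [Sf Df] [Sg Dg]|f g [Sf Df] [Sg Dg]].
- rewrite mmapC; have [Sc ->] := Siota c; split=> //.
  by rewrite big1 // => j _; rewrite mderivC rmorph0 mul0r.
- rewrite mmapXU; split=> //; rewrite (bigD1 i) //= big1 ?addr0.
    by rewrite mderivXU eqxx rmorph1 mul1r.
  by move=> j /negbTE ji; rewrite mderivXU eq_sym ji rmorph0 mul0r.
- rewrite rmorphD; split; first exact: (der_ringD derD Sf Sg).
  rewrite DD // Df Dg -big_split; apply: eq_bigr => j _.
  by rewrite mderivD rmorphD mulrDl.
- rewrite rmorphM; split; first exact: SM.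
  rewrite DM // Df Dg mulr_suml mulr_sumr -big_split; apply: eq_bigr => j _ /=.
  by rewrite mderivM rmorphD !rmorphM mulrDl mulrAC mulrA.
Qed.

(** These are the partial derivatives of polynomials in [y] over the image of [iota], extended to a
    ring that contains the [x j]. *)
Lemma alg_indep_derivations k (y : 'I_k -> L) N (x : 'I_N -> L) :
    [pchar L] =i pred0 -> alg_indep y ->
  forall i, exists S D, [/\ derivation_on S D, forall r, S (iota r) /\ D (iota r) = 0,
    forall j, S (y j) /\ D (y j) = (i == j)%:R & forall j, S (x j)].
Proof.
move=> charL indep_y i.
pose ev : {rmorphism {mpoly R[k]} -> L} := mmap iota y.
have evC r : ev r%:MP = iota r by exact: mmapC.
have evX j : ev 'X_j = y j by exact: mmapXU.
pose S a := exists G, ev G = a.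
pose D a := ev (xget 0 [set G | ev G = a]%classic)^`M(i).
(* Two polynomials with the same value have coefficients with the same image in [L], by
   independence; so have their derivatives. *)
have DE G : D (ev G) = ev G^`M(i).
  rewrite /D; have := @xgetPex _ 0 [set H | ev H = ev G]%classic (ex_intro _ G erefl).
  set H := xget _ _ => /eqP; rewrite -subr_eq0 -rmorphB => /eqP/indep_y HG.
  apply/eqP; rewrite -subr_eq0 -rmorphB -mderivB; apply/eqP.
  by apply: mmap_coeff0 => m; rewrite mcoeff_deriv raddfMn /= HG mul0rn.
have dD : derivation_on S D.
  split.
  - by exists 1; rewrite rmorph1.
  - by move=> _ _ [G <-] [H <-]; exists (G - H); rewrite rmorphB.
  - by move=> _ _ [G <-] [H <-]; exists (G * H); rewrite rmorphM.
  - by move=> _ _ [G <-] [H <-]; rewrite -rmorphD !DE mderivD rmorphD.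
  - by move=> _ _ [G <-] [H <-]; rewrite -rmorphM !DE mderivM rmorphD !rmorphM.
have [S' [D' [dD' eD Sx]]] := derivation_extension (codom x) charL dD.
exists S', D'; split=> //.
- move=> r; have Sr : S (iota r) by exists r%:MP.
  have [S'r ->] := eD _ Sr; split=> //.
  by rewrite -evC DE mderivC rmorph0.
- move=> j; have Sj : S (y j) by exists 'X_j.
  have [S'j ->] := eD _ Sj; split=> //; rewrite -evX DE mderivXU eq_sym.
  by rewrite rmorph_nat.
- by move=> j; apply: Sx; apply: codom_f.
Qed.

End AlgebraicIndependence.

Lemma mderiv_eq0 (K : fieldType) k (G : {mpoly K[k]}) : [pchar K] =i pred0 ->
  (forall i, G^`M(i) = 0) -> G = (G@_0%MM)%:MP.
Proof.
move=> charK dG; apply/mpolyP => m; rewrite mcoeffC eq_sym.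
have [<-|m0] := eqVneq 0%MM m; first by rewrite mulr1.
have [i mi] : exists i, m i != 0%N.
  apply: contrapT => nm; move/eqP: m0; apply; apply/mnmP => i; rewrite mnm0E.
  by apply/esym/eqP; apply: contrapT => /negP mi; apply: nm; exists i.
have /eqP := congr1 (mcoeff (m - U_(i))%MM) (dG i).
rewrite mcoeff_deriv mcoeff0 submK ?lep1mP // -[_ *+ _.+1]mulr_natr mulf_eq0.
by rewrite ((pcharf0P K).1 charK) orbF mulr0 => /eqP.
Qed.

(* Derivations [D_i] dual to [f] give [Omega *m Phi = 1] for the matrices
   [Omega_ij = D_i (x_j)] and [Phi_jl = d_j f_l], so [k] columns of [Omega] form an
   invertible matrix; the corresponding coordinates satisfy no relation, since the
   partial derivatives of a relation of least degree would be relations as well. *)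
Lemma alg_indep_coordinates (K L : fieldType) (iota : {rmorphism K -> L}) N
    (x : 'I_N -> L) k (f : 'I_k -> {mpoly K[N]}) :
    [pchar L] =i pred0 -> alg_indep iota (fun i => mmap iota x (f i)) ->
  exists J : 'I_k -> 'I_N, alg_indep iota (x \o J).
Proof.
move=> charL indep_f.
have charK : [pchar K] =i pred0.
  move=> p; rewrite -(charL p); apply/esym.
  by rewrite !inE -(rmorph_nat iota) fmorph_eq0.
have /fin_all_exists [S /fin_all_exists [D HD]] := alg_indep_derivations x charL indep_f.
pose Omega : 'M[L]_(N, k) := \matrix_(j, i) D i (x j).
pose Phi : 'M[L]_(k, N) := \matrix_(l, j) mmap iota x (f l)^`M(j).
have PhiOmega : Phi *m Omega = 1%:M.
  apply/matrixP => l i; rewrite !mxE.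
  have [dS iS fS xS] := HD i.
  have [_] := chain_rule dS iS xS (f l); have [_ ->] := fS l.
  rewrite eq_sym => ->; apply: eq_bigr => j _; by rewrite !mxE.
have full : row_full Omega by apply/row_fullP; exists Phi.
pose J := fullrankfun full.
have unitJ : row_free (rowsub J Omega) by rewrite row_free_unit -row_full_unit fullrowsub_full.
exists J => G; have [s] := ubnP (msize G); elim: s G => // s IH G ltGs G0.
have dG0 l : mmap iota (x \o J) G^`M(l) = 0.
  pose c := \row_l mmap iota (x \o J) G^`M(l).
  suff c0 : c = 0 by have := congr1 (fun r : 'rV_k => r 0 l) c0; rewrite !mxE.
  apply: (row_free_inj unitJ); rewrite mul0mx; apply/rowP => i; rewrite !mxE.
  have [dS iS _ xS] := HD i.
  have [_] := chain_rule dS iS (fun l => xS (J l)) G.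
  rewrite G0 (der0 dS) => H; rewrite [RHS]H; apply: eq_bigr => j _.
  by rewrite !mxE.
have dG i : G^`M(i) = 0.
  apply/eqP; apply: contrapT => /negP nz_dG.
  have : iota (G^`M(i))@_(mlead (G^`M(i))) = 0.
    apply: IH => //; apply: leq_trans (_ : msize G <= s)%N => //; rewrite -mlead_deg //.
    have := mlead_supp nz_dG; rewrite mcoeff_msupp mcoeff_deriv => Gm.
    have : (mlead G^`M(i) + U_(i))%MM \in msupp G.
      by rewrite mcoeff_msupp; apply: contraNneq Gm => ->; rewrite mul0rn.
    by move/msize_mdeg_lt; rewrite mdegD mdeg1 addn1.
  by move/eqP; rewrite fmorph_eq0 mleadc_eq0 (negbTE nz_dG).
have := G0; rewrite (mderiv_eq0 charK dG) mmapC => G00 m.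
by rewrite mcoeffC rmorphM G00 mul0r.
Qed.

(** * Transcendence degree from chains of prime ideals *)

Section PrimeChains.
Variables (K : fieldType) (R : comNzRingType) (iota : {rmorphism K -> R}).

(** For a prime [I], this bounds from below the transcendence degree over [K] of the functions
    modulo [I]. *)
Definition indep_mod (I : R -> Prop) k :=
  exists f : 'I_k -> R, forall G : {mpoly K[k]}, I (mmap iota f G) -> G = 0.

Lemma mwiden_coeff k (G : {mpoly K[k]}) (m : 'X_{1..k.+1}) : m ord_max != 0%N -> (mwiden G)@_m = 0.
Proof.
move=> m0; elim/mpolyind: G => [|c m' G _ _ IH]; first by rewrite mwiden0 mcoeff0.
rewrite mwidenD mwidenZ mwidenX mcoeffD mcoeffZ mcoeffX IH addr0.
case: eqP => [e|_]; last by rewrite mulr0.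
by rewrite -e mnmwiden_ordmax in m0.
Qed.

Lemma mpoly_split_last k (G : {mpoly K[k.+1]}) : exists G0 G1,
  G = mwiden G0 + 'X_ord_max * G1 /\ forall m, G1@_m = G@_(m + U_(ord_max)).
Proof.
suff [G0 [G1 e]] : exists G0 G1, G = mwiden G0 + 'X_ord_max * G1.
  exists G0, G1; split=> // m; rewrite e mcoeffD mwiden_coeff ?add0r.
    by rewrite mulrC addmC mcoeffMX.
  by rewrite mnmDE mnm1E eqxx addn1.
elim/mpolyind: G => [|c m G _ _ [G0 [G1 ->]]].
  by exists 0, 0; rewrite mwiden0 mulr0 addr0.
have [m0|m0] := eqVneq (m ord_max) 0%N.
  pose m' := [multinom m (widen_ord (leqnSn k) i) | i < k].
  exists (c *: 'X_[m'] + G0), G1; rewrite mwidenD mwidenZ mwidenX addrA.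
  congr (c *: 'X_[_] + _ + _); apply/mnmP => i.
  case: (unliftP ord_max i) => [j ->|->]; last by rewrite mnmwiden_ordmax.
  have -> : lift ord_max j = widen_ord (leqnSn k) j.
    by apply/val_inj; rewrite /= /bump leqNgt ltn_ord.
  by rewrite mnmwiden_widen mnmE.
exists G0, (c *: 'X_[m - U_(ord_max)] + G1).
rewrite mulrDr -scalerAr -mpolyXD addmC submK ?lep1mP //.
by rewrite addrCA.
Qed.

(* Append an element of [I] outside of [J] to the family: modulo [I], a relation loses
   the terms that involve it. *)
Lemma indep_modS (I J : R -> Prop) k : prime_ideal I -> prime_ideal J ->
  (forall f, J f -> I f) -> (exists2 g, I g & ~ J g) ->
  indep_mod I k -> indep_mod J k.+1.
Proof.
move=> [_ ID IM _ _] [_ _ _ _ JP] JI [g Ig nJg] [f indep_f].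
pose f' i := if unlift ord_max i is Some j then f j else g.
exists f' => G JG.
have evw G0 : mmap iota f' (mwiden G0) = mmap iota f G0.
  elim/mpoly_ring_ind: G0 => [c|i|G1 G2 e1 e2|G1 G2 e1 e2].
  - by rewrite mwidenC !mmapC.
  - rewrite mwidenX mnmwiden1 !mmapXU /f'.
    have -> : widen_ord (leqnSn k) i = lift ord_max i.
      by apply/val_inj; rewrite /= /bump leqNgt ltn_ord.
    by rewrite liftK.
  - by rewrite mwidenD !rmorphD /= e1 e2.
  - by rewrite mwidenM !rmorphM /= e1 e2.
have [d] : exists d, forall m : 'X_{1..k.+1}, (d <= m ord_max)%N -> G@_m = 0.
  exists (msize G) => m le_m; apply/eqP; rewrite mcoeff_eq0.
  apply: msize_mdeg_ge; apply: leq_trans le_m _.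
  by rewrite mdegE (bigD1 ord_max) //= leq_addr.
elim: d G JG => [|d IH] G JG Gd; first by apply/mpolyP => m; rewrite Gd ?mcoeff0.
have [G0 [G1 [eG cG1]]] := mpoly_split_last G.
have eJ : mmap iota f' G = mmap iota f G0 + mmap iota f' G1 * g.
  by rewrite {1}eG rmorphD rmorphM /= evw mmapXU mulrC /f' unlift_none.
have G00 : G0 = 0.
  apply: indep_f; have -> : mmap iota f G0 = mmap iota f' G + - mmap iota f' G1 * g.
    by rewrite eJ mulNr addrK.
  by apply: ID; [apply: JI|apply: IM].
(* As [J] is prime and [g] is outside of it, [G1] is again a relation, of smaller degree in the last
   variable. *)
suff G10 : G1 = 0 by rewrite eG G00 G10 mwiden0 mulr0 addr0.
apply: IH => [|m le_m]; last first.
  by rewrite cG1 Gd // mnmDE mnm1E eqxx addn1.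
by move: JG; rewrite eJ G00 raddf0 add0r => /JP[].
Qed.
End PrimeChains.

(** * Lines and closed sets *)

Section Lines.
Variables (K R : comNzRingType) (iota : {rmorphism K -> R}) (N : nat).

(** Coefficients are pushed along [iota] so that the same construction serves for lines over [K] and
    for the line through a generic pair of vectors. *)
Definition line (a b : 'I_N -> R) (f : {mpoly K[N]}) : {poly R} :=
  mmap (polyC \o iota) (fun i => (a i)%:P + (b i)%:P * 'X) f.

Lemma lineC a b c : line a b c%:MP = (iota c)%:P.
Proof. exact: mmapC. Qed.

Lemma lineX a b i : line a b 'X_i = (a i)%:P + (b i)%:P * 'X.
Proof. exact: mmapXU. Qed.

Lemma lineD a b : {morph line a b : f g / f + g}.
Proof. by move=> f g; rewrite /line rmorphD. Qed.

Lemma lineM a b : {morph line a b : f g / f * g}.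
Proof. by move=> f g; rewrite /line rmorphM. Qed.

Lemma line0 a b : line a b 0 = 0.
Proof. exact: rmorph0. Qed.

Lemma line1 a b : line a b 1 = 1.
Proof. exact: rmorph1. Qed.

Lemma horner_line a b f t : (line a b f).[t] = mmap iota (fun i => a i + b i * t) f.
Proof.
elim/mpoly_ring_ind: f => [c|i|f g ef eg|f g ef eg].
- by rewrite lineC mmapC hornerC.
- by rewrite lineX mmapXU hornerD hornerMX !hornerC.
- by rewrite lineD hornerD ef eg rmorphD.
- by rewrite lineM hornerM ef eg rmorphM.
Qed.

Lemma deriv_line a b f : (line a b f)^`() = \sum_i (b i)%:P * line a b f^`M(i).
Proof.
elim/mpoly_ring_ind: f => [c|i|f g ef eg|f g ef eg].
- rewrite lineC derivC big1 // => i _.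
  by rewrite mderivC line0 mulr0.
- rewrite lineX derivD derivC derivM derivX derivC mul0r !add0r mulr1.
  rewrite (bigD1 i) //= big1 ?addr0 => [|j /negbTE ji]; rewrite mderivXU.
    by rewrite eqxx line1 mulr1.
  by rewrite eq_sym ji line0 mulr0.
- rewrite lineD derivD ef eg -big_split; apply: eq_bigr => i _ /=.
  by rewrite mderivD lineD mulrDr.
- rewrite lineM derivM ef eg mulr_suml mulr_sumr -big_split; apply: eq_bigr => i _ /=.
  rewrite mderivM lineD !lineM mulrDr.
  by congr (_ + _); [rewrite mulrA|apply: mulrCA].
Qed.

Lemma mmap_homog (a : 'I_N -> R) d c f : f \is d.-homog ->
  mmap iota (fun i => c * a i) f = c ^+ d * mmap iota a f.
Proof.
move=> /dhomogP hf0; have {hf0} hf : {in msupp f, forall m, mdeg m = d} by exact: hf0.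
rewrite /mmap mulr_sumr [RHS]big_seq [LHS]big_seq.
apply: eq_bigr => m /hf dm; rewrite mulrCA; congr (_ * _).
rewrite /mmap1 -dm mdegE -prodrXr -big_split; apply: eq_bigr => i _ /=.
by rewrite exprMn.
Qed.

(** The direction [b] is the point at infinity of the parameter; the coefficient of degree [d]
    records the value there, so no point of the projective line is lost. *)
Lemma line_homog a b d f : f \is d.-homog ->
  (size (line a b f) <= d.+1)%N /\ (line a b f)`_d = mmap iota b f.
Proof.
(* A multiplicative condition, hence enough to check on the factors [a_i + b_i X] of a monomial. *)
pose T e (c : R) (p : {poly R}) := (size p <= e.+1)%N /\ p`_e = c.
have TM e e' c c' p p' : T e c p -> T e' c' p' -> T (e + e')%N (c * c') (p * p').
  move=> [sp <-] [sp' <-]; split.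
    apply: leq_trans (size_polyMleq _ _) _.
    by rewrite -subn1 leq_subLR add1n -addnS -addSn leq_add.
  have le_e : (e < (e + e').+1)%N by rewrite ltnS leq_addr.
  rewrite coefM (bigD1 (Ordinal le_e)) //= addKn big1 ?addr0 // => i ne_i.
  case: (ltnP e i) => lei; first by rewrite [p`_i]nth_default ?mul0r // (leq_trans sp).
  rewrite [p'`_ _]nth_default ?mulr0 //; apply: leq_trans sp' _.
  have lt_i : (i < e)%N by rewrite ltn_neqAle lei andbT -(inj_eq val_inj) in ne_i *.
  by rewrite ltn_subRL ltn_add2r.
have TX e c p k : T e c p -> T (e * k)%N (c ^+ k) (p ^+ k).
  move=> Tp; elim: k => [|k IH].
    by rewrite !expr0 muln0; split; rewrite ?size_poly1 ?coef1.
  by rewrite !exprS mulnS; apply: TM.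
move=> /dhomogP hf0; have {hf0} hf : {in msupp f, forall m, mdeg m = d} by exact: hf0.
rewrite /line /mmap.
suff Tm m : T (mdeg m) (mmap1 b m) (mmap1 (fun i => (a i)%:P + (b i)%:P * 'X) m).
  split.
    rewrite big_seq; apply: (big_ind (fun p : {poly R} => (size p <= d.+1)%N)).
    - by rewrite size_poly0.
    - by move=> p q sp sq; apply: leq_trans (size_polyD _ _) _; rewrite geq_max sp.
    - move=> m /hf dm; rewrite mul_polyC; apply: leq_trans (size_scale_leq _ _) _.
      by have [+ _] := Tm m; rewrite dm.
  rewrite coef_sum big_seq [RHS]big_seq; apply: eq_bigr => m /hf dm.
  by rewrite coefCM; have [_] := Tm m; rewrite dm => ->.
rewrite /mmap1 mdegE.
elim/big_rec3: _ => [|i c p e _ Te]; first by split; rewrite ?size_poly1 ?coef1.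
apply: TM => //; suff /TX : T 1%N (b i) ((a i)%:P + (b i)%:P * 'X).
  by move=> /(_ (m i)); rewrite mul1n.
split.
  apply: leq_trans (size_polyD _ _) _; rewrite geq_max.
  rewrite (leq_trans (size_polyC_leq1 _)) //.
  by rewrite mul_polyC (leq_trans (size_scale_leq _ _)) ?size_polyX.
by rewrite coefD coefC coefCM coefX add0r mulr1.
Qed.
End Lines.

Lemma map_line (K R R' : comNzRingType) (iota : {rmorphism K -> R})
    (phi : {rmorphism R -> R'}) N (a b : 'I_N -> R) f :
  map_poly phi (line iota a b f) = line (phi \o iota) (phi \o a) (phi \o b) f.
Proof.
elim/mpoly_ring_ind: f => [c|i|f g ef eg|f g ef eg].
- by rewrite !lineC map_polyC.
- by rewrite !lineX rmorphD rmorphM /= !map_polyC map_polyX.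
- by rewrite !lineD rmorphD /= ef eg.
- by rewrite !lineM rmorphM /= ef eg.
Qed.

Section CharacteristicZero.
Variables (K : fieldType) (charK : [pchar K] =i pred0).

Lemma natr_inj_char0 : injective (fun k => k%:R : K).
Proof.
suff lt j k : (j < k)%N -> j%:R != k%:R :> K.
  move=> j k /eqP jk; case: (ltngtP j k) => // /lt; first by rewrite jk.
  by rewrite eq_sym jk.
move=> jk; rewrite eq_sym -subr_eq0 -natrB ?(ltnW jk) //.
by rewrite ((pcharf0P K).1 charK) subn_eq0 -ltnNge.
Qed.

Lemma poly_roots_nat (p : {poly K}) d : (size p <= d)%N ->
  (forall k, (k < d)%N -> p.[k%:R] = 0) -> p = 0.
Proof.
move=> sp p0; apply/eqP; apply: contrapT => /negP nz_p; suff: false by [].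
have := max_poly_roots nz_p (rs := [seq k%:R | k <- iota 0 d]).
rewrite size_map size_iota ltnNge sp; apply.
  rewrite all_map; apply/allP => k; rewrite mem_iota => /andP[_ lt_k].
  by apply/rootP; apply: p0.
by rewrite (map_inj_uniq natr_inj_char0) iota_uniq.
Qed.

Lemma poly_eq0_nz (p : {poly K}) : (forall t, t != 0 -> p.[t] = 0) -> p = 0.
Proof.
move=> p0; suff : 'X * p = 0 by move/eqP; rewrite mulf_eq0 polyX_eq0 => /eqP.
apply: (poly_roots_nat (leqnn _)) => k _; rewrite hornerM hornerX.
by have [->|/p0 ->] := eqVneq (k%:R : K) 0; rewrite ?mul0r ?mulr0.
Qed.

(** Join a point where [f] is nonzero to one where [g] is nonzero: on that line the product is a
    zero polynomial in one variable, although neither factor is. *)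
Lemma mpoly_nonroot_prime N (A : ('I_N -> K) -> Prop) (f g : {mpoly K[N]}) :
    (forall a b t, A a -> A b -> A (fun i => a i + (b i - a i) * t)) ->
    (forall a, A a -> (f * g).@[a] = 0) ->
  (forall a, A a -> f.@[a] = 0) \/ (forall a, A a -> g.@[a] = 0).
Proof.
move=> convA fg0; case: (pselect (forall a, A a -> f.@[a] = 0)) => [|nf]; first by left.
right=> b Ab; apply/eqP; apply: contrapT => /negP gb.
apply: nf => a Aa; apply/eqP; apply: contrapT => /negP fa.
have: line idfun a (fun i => b i - a i) (f * g) = 0.
  apply: poly_eq0_nz => t _; rewrite horner_line.
  exact: (fg0 _ (convA _ _ _ Aa Ab)).
rewrite lineM => /eqP; rewrite mulf_eq0.
case/orP => /eqP l0.
  case/negP: fa; apply/eqP; have := horner_line idfun a (fun i => b i - a i) f 0.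
  rewrite l0 horner0 => ->; apply: meval_eq => i.
  by rewrite mulr0 addr0.
case/negP: gb; apply/eqP; have := horner_line idfun a (fun i => b i - a i) g 1.
rewrite l0 horner0 => ->; apply: meval_eq => i.
by rewrite mulr1 addrC subrK.
Qed.
End CharacteristicZero.

(** * Closed sets of the Grassmannian and ideals of families of lines *)

Section ClosedSets.
Variables (K : fieldType) (charK : [pchar K] =i pred0).

Lemma zariski_closed_ext (T : Type) N (c : T -> 'rV[K]_N) (Z Z' : T -> Prop) :
  (forall t, Z t <-> Z' t) -> zariski_closed c Z -> zariski_closed c Z'.
Proof.
move=> ZZ' [S homS ZS]; exists S => // t.
by split=> [/ZZ'/ZS|/ZS/ZZ'].
Qed.

Lemma meval_scale N (v : 'rV[K]_N) (a : K) d (f : {mpoly K[N]}) : f \is d.-homog ->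
  f.@[(a *: v) 0] = a ^+ d * f.@[v 0].
Proof.
move=> hf; rewrite -(mmap_homog idfun (v 0) a hf).
by apply: meval_eq => i; rewrite mxE.
Qed.

(** Closed sets are cut out by homogeneous polynomials. If [g] vanishes at all multiples of a
    vector, so do its homogeneous components, the field being infinite; hence arbitrary [g] are
    allowed here. *)
Lemma zariski_closed_cone (T : Type) N (c : T -> 'rV[K]_N) (F : {mpoly K[N]} -> Prop) :
  zariski_closed c (fun t => forall g, F g -> forall a, g.@[(a *: c t) 0] = 0).
Proof.
exists (fun h => exists g d, F g /\ h = pihomog mdeg d g) => [h|t].
  by move=> [g [d [_ ->]]]; exists d; apply: pihomogP.
have split_g g k a : (msize g <= k)%N ->
    g.@[(a *: c t) 0] = (\poly_(d < k) (pihomog mdeg d g).@[c t 0]).[a].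
  move=> le_k; rewrite {1}(pihomog_partitionE le_k) horner_poly raddf_sum.
  apply: eq_bigr => d _ /=; rewrite mulrC.
  exact: meval_scale (pihomogP _ _ _).
split=> [F0 h [g [d [Fg ->]]]|F0 g Fg a].
  pose k := maxn (msize g) d.+1.
  pose p := \poly_(e < k) (pihomog mdeg e g).@[c t 0].
  have p0 : p = 0.
    apply: (poly_eq0_nz charK) => a _.
    by rewrite -split_g ?leq_maxl // F0.
  have := congr1 (fun q : {poly K} => q`_d) p0.
  by rewrite coef_poly leq_max leqnn orbT coef0.
rewrite (split_g _ _ _ (leqnn _)) horner_poly big1 // => d _.
by rewrite F0 ?mul0r //; exists g, d.
Qed.

Lemma mpoly_comp_linear N M (phi : {linear 'rV[K]_N -> 'rV[K]_M}) (f : {mpoly K[M]}) :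
  exists g : {mpoly K[N]}, forall x : 'rV_N, g.@[x 0] = f.@[(phi x) 0].
Proof.
pose h k : {mpoly K[N]} := \sum_j (phi (delta_mx 0 j) 0 k) *: 'X_j.
have hE k (x : 'rV_N) : (h k).@[x 0] = phi x 0 k.
  rewrite [in RHS](row_sum_delta x) linear_sum /h raddf_sum summxE.
  by apply: eq_bigr => j _; rewrite /= mevalZ mevalXU linearZ mxE mulrC.
exists (mmap (@mpolyC N K) h f) => x.
elim/mpoly_ring_ind: f => [c|k|f g ef eg|f g ef eg].
- by rewrite mmapC !mevalC.
- by rewrite mmapXU mevalXU hE.
- by rewrite rmorphD /= !mevalD ef eg.
- by rewrite rmorphM /= !mevalM ef eg.
Qed.

Section Grassmannian.
Variable n : nat.
Implicit Types (E : Gr K n 2) (v w : 'rV[K]_n.+1).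

Definition pl_mx E : 'M[K]_n.+1 := vec_mx (pluecker E).

Lemma Gr2_basis E : exists u v, [/\ u \in sval E, v \in sval E,
   pl_mx E = u^T *m v - v^T *m u,
   forall a b, a *: u + b *: v = 0 -> a = 0 /\ b = 0
   & forall w, w \in sval E -> exists a b, w = a *: u + b *: v].
Proof.
case: E => E /= dE; pose X := vbasis E.
have sX : size X = 2 by rewrite size_tuple (eqP dE).
have mX i : (i < 2)%N -> X`_i \in E by move=> i2; rewrite vbasis_mem // mem_nth ?sX.
have bX : basis_of E X := vbasisP E.
exists X`_0, X`_1; split; [exact: mX|exact: mX|by rewrite /pl_mx mxvecK| |].
- have := basis_free bX; case: (tval X) sX => [|x [|y []]] //= _.
  rewrite free_cons span_seq1 => /andP[xy fy] a b e.
  have y0 : y != 0 by move: fy; rewrite free_cons span_nil memv0 => /andP[].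
  have a0 : a = 0.
    apply/eqP; apply: contraNT xy => a0; apply/vlineP; exists (- (a^-1 * b)).
    apply: (scalerI a0); rewrite scalerA mulrN mulrA mulfV // mul1r.
    by apply/eqP; rewrite scaleNr -addr_eq0 e.
  split=> //; move: e; rewrite a0 scale0r add0r => /eqP.
  by rewrite scaler_eq0 (negbTE y0) orbF => /eqP.
- move=> w; have : <<X>>%VS = E by exact: span_basis bX.
  move=> sp Ew; have {sp Ew} : w \in <<X>>%VS by rewrite sp.
  case: (tval X) sX => [|x [|y []]] //= _.
  rewrite span_cons span_seq1 => /memv_addP[_ /vlineP[a ->] [_ /vlineP[b ->] ->]].
  by exists a, b.
Qed.

Lemma mul_wedge (a u v : 'rV[K]_n.+1) :
  a *m (u^T *m v - v^T *m u) = (a *m u^T) 0 0 *: v - (a *m v^T) 0 0 *: u.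
Proof. by rewrite mulmxBr !mulmxA -!mul_scalar_mx -!mx11_scalar. Qed.

(** The line is the row space of its Pluecker matrix. Vectors of [E] thus become linear functions of
    the Pluecker coordinates, which makes conditions on all of them closed conditions on [E]. *)
Lemma mem_pl_mx E w : w \in sval E <-> exists a : 'rV_n.+1, w = a *m pl_mx E.
Proof.
have [u [v [Eu Ev -> indep gen]]] := Gr2_basis E.
split=> [/gen[a [b ->]]|[a ->]]; last first.
  by rewrite mul_wedge rpredB // rpredZ.
have free_uv : row_free (col_mx u v).
  apply: inj_row_free => r; rewrite -[r]hsubmxK mul_row_col.
  rewrite [lsubmx r]mx11_scalar [rsubmx r]mx11_scalar !mul_scalar_mx => /indep[-> ->].
  by rewrite raddf0 row_mx0.
have [B eB] := row_freeP free_uv.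
(* By [mul_wedge], the products of the wanted vector with [u^T] and [v^T] must be [b] and [- a]. *)
pose c : 'rV_2 := row_mx b%:M (- a)%:M.
exists (c *m B^T); rewrite mul_wedge.
have e : c *m B^T *m (col_mx u v)^T = c.
  by rewrite -mulmxA -trmx_mul eB trmx1 mulmx1.
move: e; rewrite tr_col_mx mul_mx_row => /eq_row_mx[-> ->].
by rewrite !mxE !mulr1n scaleNr opprK addrC.
Qed.

Lemma pl_mx_rows E r (A : 'M_(r, n.+1)) i : row i (A *m pl_mx E) \in sval E.
Proof. by apply/mem_pl_mx; exists (row i A); rewrite row_mul. Qed.

Lemma mem_pl_mx_rows E r (M : 'M_(r, n.+1)) :
  (forall i, row i M \in sval E) -> exists A, M = A *m pl_mx E.
Proof.
move=> ME; have /fin_all_exists[a ea] i : exists a, row i M = a *m pl_mx E.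
  by apply/mem_pl_mx.
exists (\matrix_i a i); apply/row_matrixP => i.
by rewrite row_mul rowK.
Qed.

Section Families.
Variables (r m : nat) (theta : {linear 'M[K]_(r, n.+1) -> 'rV[K]_m}).
Implicit Type f : {mpoly K[m]}.

(* [theta] encodes [r] vectors, the rows of a matrix, as a point of the affine [m]-space. *)
Definition vanishes_on f E :=
  forall M, (forall i, row i M \in sval E) -> f.@[(theta M) 0] = 0.

Lemma vanishes_on_closed f : @closedG K n (vanishes_on f).
Proof.
pose phi A : {linear 'rV[K]_(n.+1 * n.+1) -> 'rV[K]_m} := theta \o mulmx A \o vec_mx.
pose F g := exists A, forall x : 'rV_(n.+1 * n.+1), g.@[x 0] = f.@[(phi A x) 0].
apply: (zariski_closed_ext _ (zariski_closed_cone (@pluecker K n) F)) => E.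
split=> [E0 M /mem_pl_mx_rows[A ->]|f0 g [A eg] a].
  have [g eg] := mpoly_comp_linear (phi A) f.
  have := etrans (esym (eg _)) (E0 g (ex_intro _ A eg) 1).
  by rewrite scale1r.
rewrite eg; apply: f0 => i; rewrite /= linearZ /= -scalemxAr linearZ /= rpredZ //.
exact: pl_mx_rows.
Qed.

Definition family_ideal (Y : Gr K n 2 -> Prop) f := forall E, Y E -> vanishes_on f E.

(** On a single [E] the tuples form a vector space, so one of the two factors vanishes on it. This
    covers [Y] by two closed sets, and irreducibility selects one. *)
Lemma family_ideal_prime Y : irreducible (@closedG K n) Y -> prime_ideal (family_ideal Y).
Proof.
move=> [[E0 YE0] irrY]; split.
- by move=> E _ M _; rewrite meval0.
- by move=> f g f0 g0 E YE M ME; rewrite mevalD (f0 E) ?(g0 E) ?addr0.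
- by move=> f g g0 E YE M ME; rewrite mevalM (g0 E) ?mulr0.
- move=> /(_ E0 YE0 0); rewrite meval1 => h.
  have /eqP : 1 = 0 :> K by apply: h => i; rewrite linear0 mem0v.
  by rewrite oner_eq0.
move=> f g fg0; apply: irrY; try exact: vanishes_on_closed.
move=> E YE; pose A (a : 'I_m -> K) :=
  exists2 M, (forall i, row i M \in sval E) & forall i, a i = theta M 0 i.
have [] := @mpoly_nonroot_prime K charK m A f g.
- move=> a b t [M ME aM] [M' M'E bM']; exists (M + t *: (M' - M)) => i.
    by rewrite linearD linearZ linearB /= rpredD // rpredZ // rpredB.
  by rewrite linearD linearZ linearB /= !mxE aM bM' [t * _]mulrC.
- move=> a [M ME aM]; rewrite (meval_eq _ aM); exact: (fg0 E YE M ME).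
- by move=> f0; left=> M ME; apply: f0; exists M.
- by move=> g0; right=> M ME; apply: g0; exists M.
Qed.
End Families.

End Grassmannian.
End ClosedSets.

(** * Dimension of the general fibre *)

Lemma rmorph_mmap (A R S : comNzRingType) (phi : {rmorphism R -> S})
    (iota : {rmorphism A -> R}) k (h : 'I_k -> R) f :
  phi (mmap iota h f) = mmap (phi \o iota) (phi \o h) f.
Proof.
elim/mpoly_ring_ind: f => [c|i|f g ef eg|f g ef eg].
- by rewrite !mmapC.
- by rewrite !mmapXU.
- by rewrite !rmorphD /= ef eg.
- by rewrite !rmorphM /= ef eg.
Qed.

Lemma eq_mmap (A S : nzRingType) k (f f' : A -> S) (h h' : 'I_k -> S) :
  f =1 f' -> h =1 h' -> mmap f h =1 mmap f' h'.
Proof.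
move=> ef eh p; apply: eq_bigr => m _; rewrite ef; congr (_ * _).
exact: mmap1_eq.
Qed.

(** Think of [phi] as a generic point and of [psi] as a point of its closure: a determinant that is
    nonzero under [psi] is nonzero under [phi]. Lifting constant matrices [X] and [Y] that reduce
    the specialized matrix to the identity avoids choosing a minor. *)
Lemma rank_specialization (R : comNzRingType) (K L : fieldType)
    (iota : {rmorphism K -> R}) (psi : {rmorphism R -> K}) (phi : {rmorphism R -> L}) m n
    (Q : 'M[R]_(m, n)) :
    cancel iota psi -> (forall f, phi f = 0 -> psi f = 0) ->
  (\rank (map_mx psi Q) <= \rank (map_mx phi Q))%N.
Proof.
move=> iotaK ker; set A := map_mx psi Q.
have [X eX] := row_fullP (col_base_full A).
have [Y eY] := row_freeP (row_base_free A).
pose T := map_mx iota X *m Q *m map_mx iota Y.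
have psiT : map_mx psi T = 1%:M.
  have KK p q (Z : 'M_(p, q)) : map_mx psi (map_mx iota Z) = Z.
    by apply/matrixP => i j; rewrite !mxE iotaK.
  have XA : X *m (col_base A *m row_base A) = row_base A by rewrite mulmxA eX mul1mx.
  by rewrite !map_mxM /= !KK -/A -eY -XA mulmx_base.
have unitT : map_mx phi T \in unitmx.
  rewrite unitmxE unitfE det_map_mx; apply/eqP => /ker /eqP.
  by rewrite -det_map_mx psiT det1 oner_eq0.
rewrite -{1}(mxrank_unit unitT) !map_mxM /=.
by apply: leq_trans (mxrankM_maxl _ _) (mxrankM_maxr _ _).
Qed.

(** * Derivations at the generic line *)

Section GenericLine.
Variables (K : fieldType) (charK : [pchar K] =i pred0) (n d : nat).
Variables (P : {mpoly K[n.+1]}) (B : Gr K n 2 -> Prop).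
Hypotheses (irrB : irreducible (@closedG K n) B) (BP : sub B (fano P)).
Local Notation N := n.+1.
Local Notation A := {mpoly K[(2 * N)%N]}.

(* The derivatives of [P] have degree [d - 1] on a line: [d] points determine them. *)
Definition gradients (M : 'M[K]_(2, N)) : 'M[K]_(d, N) :=
  \matrix_(a, j) P^`M(j).@[(a%:R *: row 0 M + row 1 M) 0].

Let X i j : A := 'X_(mxvec_index i j).
Let emb : {rmorphism {mpoly K[N]} -> A} := mmap (@mpolyC (2 * N) K) (X 0).
Let Q : 'M[A]_(d, N) :=
  \matrix_(a, j) mmap (@mpolyC (2 * N) K) (fun i => a%:R * X 0 i + X 1 i) P^`M(j).
Let I : A -> Prop := family_ideal mxvec B.
Let at_pt (M : 'M[K]_(2, N)) : {rmorphism A -> K} := meval ((mxvec M) 0).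

Let at_ptX M i j : at_pt M (X i j) = M i j.
Proof. by rewrite /at_pt /= /X mevalXU mxvecE. Qed.

Let embC c : emb c%:MP = c%:MP.
Proof. exact: mmapC. Qed.

Let embX j : emb 'X_j = X 0 j.
Proof. exact: mmapXU. Qed.

Let at_pt_emb M g : at_pt M (emb g) = g.@[(row 0 M) 0].
Proof.
rewrite /emb /= rmorph_mmap; apply: eq_mmap => [c|j] /=; first exact: mevalC.
by rewrite at_ptX mxE.
Qed.

Let at_ptQ M : map_mx (at_pt M) Q = gradients M.
Proof.
apply/matrixP => a j; rewrite !mxE rmorph_mmap; apply: eq_mmap => [c|i] /=.
  exact: mevalC.
by rewrite rmorphD rmorphM rmorph_nat !at_ptX !mxE.
Qed.

Section FunctionField.
Variables (L : fieldType) (phi : {rmorphism A -> L}).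
Hypothesis phiI : forall f, phi f = 0 <-> I f.

Let charL : [pchar L] =i pred0.
Proof.
move=> p; rewrite -(charK p) !inE; congr (_ && _).
by rewrite -(rmorph_nat (phi \o @mpolyC (2 * N) K)) fmorph_eq0.
Qed.

(* The derivations dual to [v_(J l)] that kill [u] send [v] to tangent directions at the
   generic point, by differentiating [P (a u + v) = 0]. *)
Let indep_rank k (J : 'I_k -> 'I_N) :
  alg_indep (phi \o emb) (fun l => phi (X 1 (J l))) -> (k + \rank (map_mx phi Q) <= N)%N.
Proof.
move=> indepJ.
have /fin_all_exists[S /fin_all_exists[D HD]] :=
  alg_indep_derivations (fun j => phi (X 1 j)) charL indepJ.
pose Omega : 'M[L]_(k, N) := \matrix_(i, j) D i (phi (X 1 j)).
have freeO : row_free Omega.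
  apply/row_freeP; exists (\matrix_(j, l) (j == J l)%:R).
  apply/matrixP => i l; rewrite !mxE (bigD1 (J l)) //= big1 ?addr0.
    by rewrite !mxE eqxx mulr1; have [_ _ /(_ l)[_ ->]] := HD i.
  by move=> j /negbTE jJ; rewrite !mxE jJ mulr0.
suff /mulmx0_rank_max : Omega *m (map_mx phi Q)^T = 0.
  by rewrite mxrank_tr (eqP freeO).
apply/matrixP => i a; rewrite !mxE.
have [dD iD yD xD] := HD i; have [_ _ SM DD DM] := dD.
pose z (j : 'I_N) := phi (a%:R * X 0 j + X 1 j).
have constD c : S i (phi c%:MP) /\ D i (phi c%:MP) = 0.
  by have := iD c%:MP; rewrite /= embC.
have aXE j : phi (a%:R * X 0 j) = phi (emb (a%:R * 'X_j)).
  by rewrite (rmorphM emb) (rmorph_nat emb) embX.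
have zD j : S i (z j) /\ D i (z j) = D i (phi (X 1 j)).
  have [Sa Da] := iD (a%:R * 'X_j); rewrite /z rmorphD aXE; split.
    exact: (der_ringD dD).
  by rewrite DD // Da add0r.
have [_] := chain_rule (iota := phi \o @mpolyC (2 * N) K) dD constD (fun j => (zD j).1) P.
have -> : mmap (phi \o @mpolyC (2 * N) K) z P = 0.
  rewrite -rmorph_mmap; apply/phiI => E BE M ME.
  rewrite -/(at_pt M) rmorph_mmap.
  have := BP BE (rpredD (rpredZ a%:R (ME 0)) (ME 1)).
  move=> <-; apply: eq_mmap => [c|j] /=; first exact: mevalC.
  by rewrite rmorphD rmorphM rmorph_nat !at_ptX !mxE.
rewrite (der0 dD) => H; rewrite [RHS]H; apply: eq_bigr => j _.
by rewrite !mxE (zD j).2 mulrC rmorph_mmap.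
Qed.

(** Contrapositive of [indep_rank], brought back from [L] to the actual pairs of vectors. The
    distinguished coefficient is not identically zero on the family, so the relation stays
    nontrivial at a general [u]. *)
Lemma relation_of_rank k (J : 'I_k -> 'I_N) : (N < k + \rank (map_mx phi Q))%N ->
  exists (G : {mpoly {mpoly K[N]}[k]}) m, phi (emb G@_m) <> 0 /\
    forall E (M : 'M_(2, N)), B E -> (forall i, row i M \in sval E) ->
      mmap (meval ((row 0 M) 0)) (fun l => M 1 (J l)) G = 0.
Proof.
rewrite ltnNge => /negP lt_N; apply: contrapT => nG; apply: lt_N.
apply: (indep_rank (J := J)) => G G0 m; apply: contrapT => Gm.
apply: nG; exists G, m; split=> // E M BE ME.
have : I (mmap emb (fun l => X 1 (J l)) G).
  by apply/phiI; rewrite rmorph_mmap.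
move=> /(_ E BE M ME); rewrite -/(at_pt M) rmorph_mmap => <-.
apply/esym; apply: eq_mmap => [c|l] /=; last exact: at_ptX.
exact: at_pt_emb.
Qed.
End FunctionField.

(** [g] is the product of the distinguished coefficients over the finitely many [J]: it has to be
    fixed before the point, while [J] will depend on the point. *)
Lemma generic_relations k E (M : 'M_(2, N)) : B E -> (forall i, row i M \in sval E) ->
    (N < k + \rank (gradients M))%N ->
  exists g : {mpoly K[N]},
    (exists E' (u : 'rV_N), [/\ B E', u \in sval E' & g.@[u 0] != 0]) /\
    forall u : 'rV_N, g.@[u 0] != 0 -> forall J : 'I_k -> 'I_N,
      exists2 H : {mpoly K[k]}, H != 0 &
        forall E' (v : 'rV_N), B E' -> u \in sval E' -> v \in sval E' ->
          H.@[fun l => v 0 (J l)] = 0.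
Proof.
move=> BE ME lt_N.
have [L [phi phiI]] := prime_ideal_kernel (@family_ideal_prime K charK n 2 _ mxvec B irrB).
have {}lt_N : (N < k + \rank (map_mx phi Q))%N.
  apply: leq_trans lt_N _; rewrite leq_add2l -at_ptQ.
  apply: (@rank_specialization _ _ _ (@mpolyC (2 * N) K)) => [c|f /phiI f0].
    exact: mevalC.
  exact: (f0 E BE M ME).
have /fin_all_exists[G /fin_all_exists[m Gm]] (J : {ffun 'I_k -> 'I_N}) :=
  relation_of_rank phiI J lt_N.
exists (\prod_J (G J)@_(m J)); split.
  apply: contrapT => ng; have : phi (emb (\prod_J (G J)@_(m J))) <> 0.
    rewrite !rmorph_prod; apply/eqP/prodf_neq0 => J _; apply/eqP.
    by have [] := Gm J.
  apply; apply/phiI => E' BE' M' ME'; rewrite -/(at_pt M') at_pt_emb.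
  apply/eqP; apply: contrapT => /negP g0; apply: ng.
  by exists E', (row 0 M').
move=> u; rewrite rmorph_prod => /prodf_neq0 gu J.
have := gu [ffun l => J l] isT; set J' := [ffun l => J l] => gJ.
exists (map_mpoly (meval (u 0)) (G J')).
  apply: contraNneq gJ => H0.
  by rewrite -mcoeff_map_mpoly H0 mcoeff0.
move=> E' v BE' uE' vE'; have [_ GJ] := Gm J'.
have := GJ E' (\matrix_(i < 2) (if i == 0 then u else v)) BE'.
rewrite rowK /= => <-; last by move=> i; rewrite rowK; case: ifP.
rewrite /meval.
elim/mpoly_ring_ind: (G J') => [c|i|f g ef eg|f g ef eg].
- by rewrite map_mpolyC !mmapC.
- by rewrite map_mpolyX !mmapXU mxE ffunE.
- by rewrite !rmorphD /= ef eg.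
- by rewrite !rmorphM /= ef eg.
Qed.
End GenericLine.

(** * Chains of lines through a point *)

Section Chains.
Variables (K : fieldType) (charK : [pchar K] =i pred0) (n : nat).
Local Notation N := n.+1.
Implicit Types (E : Gr K n 2) (u v w : 'rV[K]_N) (f : {mpoly K[N]}).

Lemma wedge_mx E u w : u \in sval E -> w \in sval E ->
  exists a, u^T *m w - w^T *m u = a *: pl_mx E.
Proof.
have [p [q [_ _ -> _ gen]]] := Gr2_basis E.
move=> /gen[a [b ->]] /gen[a' [b' ->]]; exists (a * b' - b * a').
apply/matrixP => i j; rewrite !(mxE, big_ord_recl, big_ord0, addr0).
by ring.
Qed.

Lemma wedge_mx_pl E u : u \in sval E -> u != 0 ->
  exists2 w, w \in sval E & u^T *m w - w^T *m u = pl_mx E.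
Proof.
have [p [q [pE qE -> _ gen]]] := Gr2_basis E.
move=> /gen[a [b ->]] nz_u; have [a0|nz_a] := eqVneq a 0; last first.
  exists (a^-1 *: q); first exact: rpredZ.
  apply/matrixP => i j; rewrite !(mxE, big_ord_recl, big_ord0, addr0).
  by field.
have nz_b : b != 0 by apply: contraNneq nz_u => ->; rewrite a0 !scale0r addr0.
exists (- b^-1 *: p); first exact: rpredZ.
rewrite a0; apply/matrixP => i j; rewrite !(mxE, big_ord_recl, big_ord0, addr0).
by field.
Qed.

(** The ideal of the affine cone swept out by [Y], encoded as the case of one vector of
    [family_ideal] to inherit primality. *)
Definition cone_ideal (Y : Gr K n 2 -> Prop) f :=
  family_ideal [the {linear 'M[K]_(1, N) -> 'rV[K]_N} of idfun] Y f.

Lemma cone_idealP Y f :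
  cone_ideal Y f <-> forall E v, Y E -> v \in sval E -> f.@[v 0] = 0.
Proof.
split=> [f0 E v YE vE|f0 E YE M ME].
  by apply: (f0 E YE v) => i; rewrite row_id.
by apply: (f0 E) => //; have := ME 0; rewrite row_id.
Qed.

Definition space_ideal (V : {vspace 'rV[K]_N}) f := forall v, v \in V -> f.@[v 0] = 0.

Lemma space_ideal_prime V : prime_ideal (space_ideal V).
Proof.
split.
- by move=> v _; rewrite meval0.
- by move=> f g f0 g0 v Vv; rewrite mevalD f0 ?g0 ?addr0.
- by move=> f g g0 v Vv; rewrite mevalM g0 ?mulr0.
- by move=> /(_ 0 (mem0v _)); rewrite meval1 => /eqP; rewrite oner_eq0.
move=> f g fg0; pose A (a : 'I_N -> K) := exists2 v, v \in V & forall i, a i = v 0 i.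
have [] := @mpoly_nonroot_prime K charK N A f g.
- move=> a b t [v Vv av] [w Vw bw]; exists (v + t *: (w - v)) => [|i].
    by rewrite rpredD // rpredZ // rpredB.
  by rewrite !mxE av bw mulrC.
- by move=> a [v Vv av]; rewrite (meval_eq _ av); apply: fg0.
- by move=> f0; left=> v Vv; apply: f0; exists v.
- by move=> g0; right=> v Vv; apply: g0; exists v.
Qed.

Local Notation indep I k := (indep_mod (@mpolyC N K) I k).

Lemma indep_line E u : u \in sval E -> u != 0 ->
  indep (space_ideal <[u]>%VS) 1.
Proof.
move=> uE nz_u; apply: (@indep_modS _ _ _ (space_ideal 0%VS)).
- exact: space_ideal_prime.
- exact: space_ideal_prime.
- by move=> f f0 v; rewrite memv0 => /eqP ->; apply: f0; rewrite mem0v.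
- have [j uj] : exists j, u 0 j != 0.
    apply: contrapT => nj; case/negP: nz_u; apply/eqP/rowP => j; rewrite mxE.
    by apply/eqP; apply: contrapT => /negP uj; apply: nj; exists j.
  exists 'X_j.
    by move=> v; rewrite memv0 => /eqP ->; rewrite mevalXU mxE.
  by move=> /(_ u (memv_line u)); rewrite mevalXU => /eqP; apply/negP.
- exists (fun i => 0) => G; rewrite [G]nvar0_mpolyC mmapC.
  by move=> /(_ 0 (mem0v _)); rewrite mevalC => ->; rewrite mpolyC0.
Qed.

(** The point [0], the line of [u] and the cone account for the shift by 2 between the dimension of
    a family of lines through a point and that of its affine cone. *)
Lemma indep_cone Y E : irreducible (@closedG K n) Y -> Y E -> indep (cone_ideal Y) 2.
Proof.
move=> irrY YE; have [u [v [uE vE ePl free _]]] := Gr2_basis E.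
have nz_u : u != 0.
  apply/eqP => u0; have /eqP : (1 : K) = 0.
    by have [] := free 1 0; rewrite // u0 scaler0 scale0r addr0.
  by rewrite oner_eq0.
apply: (indep_modS (space_ideal_prime _) _ _ _ (indep_line uE nz_u)).
- exact: family_ideal_prime.
- move=> f /cone_idealP f0 w /vlineP[a ->]; apply: (f0 E) => //.
  exact: rpredZ.
have [i [j nz_ij]] : exists i j, pl_mx E i j != 0.
  apply: contrapT => nij; case/negP: nz_u; apply/eqP.
  have [a ->] := (mem_pl_mx E u).1 uE; rewrite (_ : pl_mx E = 0) ?mulmx0 //.
  apply/matrixP => i j; rewrite [RHS]mxE.
  by apply/eqP; apply: contrapT => /negP uj; apply: nij; exists i, j.
(* A linear form that vanishes on the line of [u]; its value at [v] is a nonzero Pluecker coordinate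
   of [E]. *)
exists (u 0 i *: 'X_j - u 0 j *: 'X_i).
  move=> w /vlineP[a ->]; rewrite mevalB !mevalZ !mevalXU !mxE.
  by ring.
move/cone_idealP => /(_ E v YE vE); rewrite mevalB !mevalZ !mevalXU => /eqP.
apply/negP; move: nz_ij; rewrite ePl !mxE !big_ord_recl !big_ord0 !mxE !addr0.
by rewrite [v 0 i * _]mulrC.
Qed.

(** Because all lines contain [u], a line is recovered from any of its vectors off [u], so strict
    inclusions of families give strict inclusions of cones. *)
Lemma indep_chain (x : Gr K n 1) u (B : Gr K n 2 -> Prop) (Z : nat -> Gr K n 2 -> Prop) k :
    u \in sval x -> u != 0 ->
    (forall i, (i <= k)%N ->
       irreducible_closed (@closedG K n) (Z i) /\ sub (Z i) (lines_through B x)) ->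
    (forall i, (i < k)%N -> sub (Z i) (Z i.+1) /\ ~ sub (Z i.+1) (Z i)) ->
  indep (cone_ideal (Z k)) k.+2.
Proof.
move=> ux nz_u; elim: k => [|k IH] irrZ strictZ.
  have [[_ irrZ0] _] := irrZ 0%N isT; have [[E ZE] _] := irrZ0.
  exact: indep_cone irrZ0 ZE.
have irrk i (le_ik : (i <= k)%N) := irrZ i (leqW le_ik).
have lek i (lt_ik : (i < k)%N) := strictZ i (ltnW lt_ik : (i < k.+1)%N).
have [[[S homS ZS] irrZk] Zkx] := irrk k (leqnn k).
have [[_ irrZk1] Zk1x] := irrZ _ (leqnn k.+1).
have [Zkk nZkk] := strictZ k (leqnn _).
apply: indep_modS (IH irrk lek).
- exact: family_ideal_prime.
- exact: family_ideal_prime.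
- by move=> f /cone_idealP f0; apply/cone_idealP => E v /Zkk; apply: f0.
have [E [ZE nZE]] : exists E, Z k.+1 E /\ ~ Z k E.
  apply: contrapT => nE; apply: nZkk => E ZE; apply: contrapT => nZE.
  by apply: nE; exists E.
have [F [SF FE]] : exists F, S F /\ F.@[pluecker E 0] <> 0.
  apply: contrapT => nF; apply: nZE; apply/ZS => F SF; apply: contrapT => FE.
  by apply: nF; exists F.
have [e homF] := homS _ SF.
(* An equation [F] of [Z k] becomes the function that sends [w] to the value of [F] at [u] wedge
   [w]; it vanishes on the cone over [Z k] but not on the next one. *)
pose phi : {linear 'rV[K]_N -> 'rV[K]_(N * N)} :=
  (mxvec \o mulmx u^T) \- (mxvec \o (mulmxr u \o trmx)).
have phiE w : phi w = mxvec (u^T *m w - w^T *m u) by rewrite linearB.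
have [g eg] := mpoly_comp_linear phi F.
have uE' E' : lines_through B x E' -> u \in sval E'.
  by move=> [_ /subvP]; apply.
exists g.
  apply/cone_idealP => E' w ZE' wE'; rewrite eg phiE.
  have [a ->] := wedge_mx (uE' _ (Zkx _ ZE')) wE'.
  rewrite linearZ /= vec_mxK (meval_scale _ _ homF).
  by rewrite ((ZS E').1 ZE' F SF) mulr0.
have [w wE ew] := wedge_mx_pl (uE' _ (Zk1x _ ZE)) nz_u.
move=> /cone_idealP /(_ E w ZE wE); rewrite eg phiE ew vec_mxK.
exact: FE.
Qed.
End Chains.

Section FibreDimension.
Variables (K : fieldType) (charK : [pchar K] =i pred0) (n d : nat).
Local Notation N := n.+1.
Variables (P : {mpoly K[N]}) (B : Gr K n 2 -> Prop).
Hypotheses (irrB : irreducible (@closedG K n) B) (BP : sub B (fano P)).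

Lemma mem_proj_coord (x : Gr K n 1) : proj_coord x \in sval x.
Proof. exact: memv_pick. Qed.

Lemma proj_coord_neq0 (x : Gr K n 1) : proj_coord x != 0.
Proof. by rewrite vpick0 -dimv_eq0; case: x => x /= /eqP ->. Qed.

Lemma point_of (v : 'rV[K]_N) : v != 0 -> exists x : Gr K n 1, sval x = <[v]>%VS.
Proof.
move=> nz_v; have d1 : \dim <[v]> == 1%N by rewrite dim_vline nz_v.
by exists (exist _ <[v]>%VS d1).
Qed.

(** The polynomial [g] need not be homogeneous, so its nonvanishing is tested on all multiples of
    the coordinates of a point. *)
Lemma general_point (g : {mpoly K[N]}) (Q : Gr K n 1 -> Prop) E (v : 'rV_N) :
    generically (@closedP K n) (swept B) Q ->
    B E -> v \in sval E -> g.@[v 0] != 0 ->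
  exists (x : Gr K n 1) (u : 'rV_N), [/\ Q x, u \in sval x, u != 0 & g.@[u 0] != 0].
Proof.
move=> [Z [_ [_ dense] QZ]] BE vE gv.
pose F := [set g]%classic.
have : exists (x : Gr K n 1) a, [/\ swept B x, ~ Z x & g.@[(a *: proj_coord x) 0] != 0].
  apply: contrapT => nx.
  have g0 : sub (swept B) (fun x => forall h, F h -> forall a, h.@[(a *: proj_coord x) 0] = 0).
    apply: dense; first exact: zariski_closed_cone.
    move=> x [Bx nZx] _ -> a; apply: contrapT => /eqP ga.
    by apply: nx; exists x, a.
  have zero_at x a : swept B x -> v = a *: proj_coord x -> False.
    move=> Bx va; have := g0 x Bx g erefl a.
    by rewrite -va => /eqP; apply/negP.
  have in_line w (x : Gr K n 1) : sval x = <[w]>%VS -> w \in sval E -> swept B x.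
    by move=> ex wE; exists E; split=> //; rewrite ex -memvE.
  (* The zero vector represents no point; it is then reached as the multiple by 0 of the coordinates
     of any point of [E]. *)
  have [v0|nz_v] := eqVneq v 0.
    have [w [q [wE _ _ free _]]] := Gr2_basis E.
    have nz_w : w != 0.
      apply/eqP => w0; have /eqP : (1 : K) = 0.
        by have [] := free 1 0; rewrite // w0 scaler0 scale0r addr0.
      by rewrite oner_eq0.
    have [x ex] := point_of nz_w.
    by apply: (zero_at x 0 (in_line _ _ ex wE)); rewrite v0 scale0r.
  have [x ex] := point_of nz_v.
  have : v \in <[proj_coord x]>%VS.
    suff -> : <[proj_coord x]>%VS = sval x by rewrite ex memv_line.
    apply/eqP; rewrite eqEdim -memvE mem_proj_coord dim_vline proj_coord_neq0.
    by case: (x) => y /= /eqP ->.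
  by move=> /vlineP[a va]; apply: (zero_at x a (in_line _ _ ex vE)).
move=> [x [a [Bx nZx ga]]].
(* The scalar [a] may be 0; as [g] is not identically zero on this line, some nonzero multiple works
   as well. *)
have [t nz_t gt] : exists2 t, t != 0 & g.@[(t *: proj_coord x) 0] != 0.
  apply: contrapT => nt; case/negP: ga; apply/eqP.
  pose l := line idfun (fun _ => 0) (proj_coord x 0) g.
  have lE t : l.[t] = g.@[(t *: proj_coord x) 0].
    rewrite horner_line; apply: meval_eq => i.
    by rewrite add0r mxE mulrC.
  rewrite -lE (_ : l = 0) ?horner0 //; apply: (poly_eq0_nz charK) => t nz_t.
  by rewrite lE; apply/eqP; apply: contrapT => /negP gt; apply: nt; exists t.
exists x, (t *: proj_coord x); split=> //.
- exact: QZ.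
- by rewrite rpredZ // mem_proj_coord.
- by rewrite scaler_eq0 negb_or nz_t proj_coord_neq0.
Qed.

Lemma mmap_mpolyX (f : {mpoly K[N]}) : mmap (@mpolyC N K) (fun i => 'X_i) f = f.
Proof.
elim/mpoly_ring_ind: f => [c|i|f g ef eg|f g ef eg].
- by rewrite mmapC.
- by rewrite mmapXU.
- by rewrite rmorphD /= ef eg.
- by rewrite rmorphM /= ef eg.
Qed.

(* By [gradients_kernel], [N - \rank (gradients d P M)] is the dimension of the space of
   the [w] such that w _| P vanishes on [E], which modulo [E] contains the tangent space
   at [E] of the fibre. *)
Lemma fibre_dimension c E (M : 'M[K]_(2, N)) :
    generically (@closedP K n) (swept B)
      (fun x => has_chain (@closedG K n) (lines_through B x) c) ->
    B E -> (forall i, row i M \in sval E) ->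
  (c.+2 + \rank (gradients d P M) <= N)%N.
Proof.
move=> genB BE ME; rewrite leqNgt; apply/negP => lt_N.
have [g [[E' [v [BE' vE' gv]]] rel]] := generic_relations charK irrB BP BE ME lt_N.
have [x [u [[Z [irrZ strictZ]] ux nz_u gu]]] := general_point genB BE' vE' gv.
have [f indep_f] := indep_chain charK ux nz_u irrZ strictZ.
have [[_ irrZc] Zcx] := irrZ c (leqnn c).
have [L [phi phiI]] := prime_ideal_kernel (@family_ideal_prime K charK n 1 _ idfun _ irrZc).
pose iota : {rmorphism K -> L} := phi \o @mpolyC N K.
have charL : [pchar L] =i pred0.
  by move=> p; rewrite -(charK p) !inE -(rmorph_nat iota) fmorph_eq0.
have phiE h : mmap iota (fun i => phi 'X_i) h = phi h.
  by rewrite -[in RHS](mmap_mpolyX h) rmorph_mmap.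
(* The chain gives [c + 2] independent functions on the cone over [Z c], hence as many independent
   coordinates; [rel] supplies a relation between precisely these. *)
have [|J indepJ] := @alg_indep_coordinates _ _ iota _ (fun i => phi 'X_i) _ f charL.
  move=> G.
  have -> : mmap iota (fun i => mmap iota (fun j => phi 'X_j) (f i)) G =
            phi (mmap (@mpolyC N K) f G).
    by rewrite rmorph_mmap; apply: eq_mmap => // i; rewrite phiE.
  by move=> /phiI/indep_f -> m; rewrite mcoeff0 rmorph0.
have [H nz_H relH] := rel u gu J.
case/negP: nz_H; apply/eqP/mpolyP => m; rewrite mcoeff0.
apply/eqP; rewrite -(fmorph_eq0 iota); apply/eqP; apply: indepJ.
have -> : mmap iota ((fun i => phi 'X_i) \o J) H =
          phi (mmap (@mpolyC N K) (fun l => 'X_(J l)) H) by rewrite rmorph_mmap.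
apply/phiI; apply/cone_idealP => E1 w ZE1 wE1.
have [BE1 xE1] := Zcx _ ZE1.
rewrite rmorph_mmap -(relH E1 w BE1 (subvP xE1 _ ux) wE1).
by apply: eq_mmap => [a|l] /=; [exact: mevalC|exact: mevalXU].
Qed.
End FibreDimension.

(** * Singular points and the normal form *)

Lemma mderiv_homog (R : comNzRingType) N d (P : {mpoly R[N]}) j : P \is d.-homog ->
  P^`M(j) \is d.-1.-homog.
Proof.
move=> homP; apply/dhomogP => m; rewrite mcoeff_msupp mcoeff_deriv => Pm.
have : (m + U_(j))%MM \in msupp P.
  by rewrite mcoeff_msupp; apply: contraNneq Pm => ->; rewrite mul0rn.
by move=> /(dhomog_mf homP) /=; rewrite mdegD mdeg1 addn1 => <-.
Qed.

Section Contraction.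
Variables (K : fieldType) (charK : [pchar K] =i pred0) (n d : nat).
Local Notation N := n.+1.
Variables (P : {mpoly K[N]}) (homP : P \is d.-homog) (d_gt0 : (0 < d)%N).
Implicit Types (E : Gr K n 2) (u v w z : 'rV[K]_N).

Lemma contractE w z : (contract P w).@[z 0] = \sum_j w 0 j * P^`M(j).@[z 0].
Proof. by rewrite /contract raddf_sum; apply: eq_bigr => j _; rewrite /= mevalZ. Qed.

Lemma contractD w w' z :
  (contract P (w + w')).@[z 0] = (contract P w).@[z 0] + (contract P w').@[z 0].
Proof.
by rewrite !contractE -big_split; apply: eq_bigr => j _; rewrite mxE mulrDl.
Qed.

Lemma contractZ a w z : (contract P (a *: w)).@[z 0] = a * (contract P w).@[z 0].
Proof. by rewrite !contractE mulr_sumr; apply: eq_bigr => j _; rewrite mxE mulrA. Qed.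

Lemma contract_delta j z : (contract P (delta_mx 0 j)).@[z 0] = P^`M(j).@[z 0].
Proof.
rewrite contractE (bigD1 j) //= big1 => [|i /negbTE ij]; rewrite !mxE eqxx /=.
  by rewrite eqxx mul1r addr0.
by rewrite ij mul0r.
Qed.

Lemma contract_homog w : contract P w \is d.-1.-homog.
Proof. by rewrite rpred_sum // => j _; rewrite rpredZ // mderiv_homog. Qed.

Lemma contract_span (X : seq 'rV[K]_N) z :
  (forall w, w \in X -> (contract P w).@[z 0] = 0) ->
  forall w, w \in <<X>>%VS -> (contract P w).@[z 0] = 0.
Proof.
move=> X0 w /(coord_span (X := in_tuple X)) ->.
elim/big_ind: _ => [|w1 w2 e1 e2|i _].
- by rewrite contractE big1 // => j _; rewrite mxE mul0r.
- by rewrite contractD e1 e2 addr0.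
- by rewrite contractZ X0 ?mulr0 // mem_nth.
Qed.

Lemma horner_line_rV (f : {mpoly K[N]}) u v t :
  (line idfun (u 0) (v 0) f).[t] = f.@[(u + t *: v) 0].
Proof. by rewrite horner_line; apply: meval_eq => i; rewrite !mxE mulrC. Qed.

Lemma horner_deriv_line u v t :
  ((line idfun (u 0) (v 0) P)^`()).[t] = (contract P v).@[(u + t *: v) 0].
Proof.
rewrite deriv_line horner_sum contractE; apply: eq_bigr => j _.
by rewrite hornerM hornerC horner_line_rV.
Qed.

Lemma contract_tangent E w v : fano P E -> w \in sval E -> v \in sval E ->
  (contract P w).@[v 0] = 0.
Proof.
move=> PE wE vE; have l0 : line idfun (v 0) (w 0) P = 0.
  apply: (poly_eq0_nz charK) => t _; rewrite horner_line_rV.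
  by apply: PE; rewrite rpredD // rpredZ.
have := horner_deriv_line v w 0.
by rewrite l0 deriv0 horner0 scale0r addr0 => <-.
Qed.

(** Up to scaling, the vectors [v + t u] miss only the direction of [u], which is reached by
    continuity: a polynomial in [c] that vanishes for [c != 0] vanishes at 0. *)
Lemma vanish_on_span2 (f : {mpoly K[N]}) e u v z : f \is e.-homog ->
    (forall t, f.@[(v + t *: u) 0] = 0) ->
  (exists a b, z = a *: u + b *: v) -> f.@[z 0] = 0.
Proof.
move=> homf f0 [a [b ->]].
have nz c : c != 0 -> f.@[(a *: u + c *: v) 0] = 0.
  move=> nz_c; have -> : a *: u + c *: v = c *: (v + (a / c) *: u).
    by rewrite scalerDr scalerA mulrCA mulfV // mulr1 addrC.
  by rewrite (meval_scale _ _ homf) f0 mulr0.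
have [->|/nz //] := eqVneq b 0.
have l0 : line idfun ((a *: u) 0) (v 0) f = 0.
  by apply: (poly_eq0_nz charK) => c /nz fc; rewrite horner_line_rV.
by have := horner_line_rV f (a *: u) v 0; rewrite l0 horner0 => <-.
Qed.

Lemma gradients_kernel (M : 'M[K]_(2, N)) w z :
    w *m (gradients d P M)^T = 0 -> (exists a b, z = a *: row 0 M + b *: row 1 M) ->
  (contract P w).@[z 0] = 0.
Proof.
move=> wM zM; apply: (vanish_on_span2 (contract_homog w) _ zM) => t.
rewrite -horner_line_rV (_ : line _ _ _ _ = 0) ?horner0 //.
have [sz _] := line_homog idfun (row 1 M 0) (row 0 M 0) (contract_homog w).
apply: (poly_roots_nat charK (d := d)) => [|k lt_k]; first by rewrite -(prednK d_gt0).
rewrite horner_line_rV contractE.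
have := congr1 (fun r : 'rV_d => r 0 (Ordinal lt_k)) wM; rewrite !mxE => H.
rewrite -[RHS]H; apply: eq_bigr => j _; rewrite !mxE.
by congr (_ * _); apply: meval_eq => i; rewrite !mxE addrC.
Qed.
End Contraction.

Section Duals.
Variables (K : fieldType) (n : nat) (E : {vspace 'rV[K]_n.+1}).

Lemma dual_separates (v : subvs_of E) : v != 0 ->
  exists2 a : dual E, a \in vbasis {: dual E} & (a v : K) != 0.
Proof.
move=> nz_v; apply: contrapT => na.
have all0 (b : dual E) : b v = 0.
  rewrite (coord_vbasis (memvf b)) sum_lfunE big1 // => i _.
  rewrite scale_lfunE; suff -> : (vbasis {: dual E})`_i v = 0 by rewrite scaler0.
  apply/eqP; apply: contrapT => /negP bv; apply: na; exists (vbasis {: dual E})`_i => //.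
  by rewrite mem_nth ?size_tuple.
case/negP: nz_v; apply/eqP; rewrite (coord_vbasis (memvf v)) big1 // => i _.
have := all0 (linfun (coord (vbasis {: subvs_of E}) i : subvs_of E -> K^o)).
by rewrite lfunE /= => ->; rewrite scale0r.
Qed.

Lemma dual_pair : \dim E == 2 -> exists (e1 e2 : subvs_of E) (a1 a2 : dual E),
  [/\ basis_of {: dual E} [:: a1; a2], a1 e1 = 1, a1 e2 = 0, a2 e1 = 0 & a2 e2 = 1].
Proof.
move=> dE; have d2 : \dim {: subvs_of E} = 2 by rewrite dimvf; apply/eqP.
have [X bX] : exists X : 2.-tuple (subvs_of E), basis_of {: subvs_of E} X.
  by exists (tcast d2 (vbasis _)); rewrite val_tcast vbasisP.
pose a (i : 'I_2) : dual E := linfun (coord X i : subvs_of E -> K^o).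
have aE i v : a i v = coord X i v by rewrite lfunE.
have aX (i j : 'I_2) : a i X`_j = (j == i)%:R :> K.
  by rewrite aE (coord_free _ _ (basis_free bX)).
exists X`_(@ord0 1), X`_(@ord_max 1), (a ord0), (a ord_max); split; try by rewrite aX.
apply/andP; split; last first.
  rewrite free_cons span_seq1 free_cons span_nil memv0; apply/and3P; split=> //.
  - apply/vlineP => -[c e]; have := aX ord0 ord0; rewrite e scale_lfunE aX.
    by move/eqP; rewrite scaler0 eq_sym oner_eq0.
  - apply/eqP => e; have := aX ord_max ord_max; rewrite e zero_lfunE.
    by move/eqP; rewrite eq_sym oner_eq0.
  - by rewrite /free span_nil dimv0.
rewrite eqEsubv subvf /=.
apply/subvP => b _.
have -> : b = (b X`_(@ord0 1) : K) *: a ord0 + (b X`_(@ord_max 1) : K) *: a ord_max.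
  apply/lfunP => v; rewrite add_lfunE !scale_lfunE !aE.
  rewrite {1}(coord_basis bX (memvf v)) linear_sum !big_ord_recl big_ord0 addr0 !linearZ.
  rewrite (_ : lift ord0 ord0 = ord_max); last exact: val_inj.
  by congr (_ + _); apply: mulrC.
by rewrite span_cons span_seq1 memv_add // memvZ // memv_line.
Qed.
End Duals.

Section NormalForm.
Variables (K : closedFieldType) (charK : [pchar K] =i pred0) (n d : nat).
Local Notation N := n.+1.
Variables (P : {mpoly K[N]}) (homP : P \is d.-homog) (d_gt0 : (0 < d)%N).
Variables (E : Gr K n 2) (PE : fano P E).

Lemma ker_sigma_tensor (N0 : {vspace tensors (sval E)}) a w :
    is_ker_sigma P N0 -> (tensor a w \in N0 <->
  forall v : subvs_of (sval E), (a v : K) * (contract P w).@[(vsval v) 0] = 0).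
Proof.
move=> kerN; split=> [/kerN H v|H]; first by rewrite -sigma_tensor.
by apply/kerN => v; rewrite sigma_tensor.
Qed.

Lemma sub_Pi N0 Pi (U : {vspace 'rV[K]_N}) : is_ker_sigma P N0 -> is_Pi (E := sval E) N0 Pi ->
    (sval E <= U)%VS ->
    (forall w v, w \in U -> v \in sval E -> (contract P w).@[v 0] = 0) -> (U <= Pi)%VS.
Proof.
move=> kerN [_ _ maxPi] EU U0; apply: maxPi => //.
apply/span_subvP => _ /allpairsP[[a w] [_ /= wU ->]].
apply/(ker_sigma_tensor _ _ kerN) => v.
by rewrite U0 ?mulr0 ?subvsP // vbasis_mem.
Qed.

Lemma Pi_contract N0 Pi w v : is_ker_sigma P N0 -> is_Pi (E := sval E) N0 Pi ->
  w \in vbasis Pi -> v \in sval E -> v != 0 -> (contract P w).@[v 0] = 0.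
Proof.
move=> kerN [_ /span_subvP PiN _] wPi vE nz_v.
have eV : vsval (vsproj (sval E) v) = v by rewrite vsprojK.
have [|a aV av] := @dual_separates _ _ (sval E) (vsproj (sval E) v).
  by apply: contraNneq nz_v => v0; rewrite -eV v0.
have /(ker_sigma_tensor _ _ kerN) : tensor a w \in N0.
  by apply: PiN; apply: allpairs_f.
move=> /(_ (vsproj (sval E) v)) /eqP; rewrite mulf_eq0 (negbTE av) eV.
by move/eqP.
Qed.

(** The kernel of the gradients, enlarged by [E], satisfies the condition for which [Pi] is the
    largest solution; enlarging is harmless by [contract_tangent]. *)
Lemma dim_Pi N0 Pi (M : 'M[K]_(2, N)) : is_ker_sigma P N0 -> is_Pi (E := sval E) N0 Pi ->
    (forall z, z \in sval E -> exists a b, z = a *: row 0 M + b *: row 1 M) ->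
  (N - \rank (gradients d P M) <= \dim Pi)%N.
Proof.
move=> kerN PiP genM; set A := gradients d P M.
pose R := row_base (kermx A^T); pose r := \rank (kermx A^T).
pose X := [tuple row i R | i < r].
have RA i : row i R *m A^T = 0.
  by apply/sub_kermxP; rewrite (submx_trans (row_sub _ _)) // eq_row_base.
have freeX : free X.
  apply/freeP => k kX i.
  suff : \row_j k j = 0 by move/rowP/(_ i); rewrite !mxE.
  apply: (row_free_inj (row_base_free (kermx A^T))); rewrite mul0mx mulmx_sum_row -[RHS]kX.
  by apply: eq_bigr => j _; rewrite mxE -tnth_nth tnth_mktuple.
have -> : (N - \rank A)%N = \dim <<X>>%VS.
  by rewrite (eqP freeX) size_tuple /r mxrank_ker mxrank_tr.
apply: dimvS; apply: subv_trans (addvSr (sval E) _) _.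
apply: (sub_Pi kerN PiP (addvSl _ _)) => w z /memv_addP[e eE [x xX ->]] zE.
rewrite contractD (contract_tangent charK PE) // add0r.
apply: contract_span xX => _ /mapP[i _ ->].
exact: (gradients_kernel charK homP d_gt0 (RA i) (genM z zE)).
Qed.

Lemma singular_point z : z \in sval E -> z != 0 ->
    (forall j, P^`M(j).@[z 0] = 0) ->
  exists2 x : Gr K n 1, (sval x <= sval E)%VS & singular P x.
Proof.
move=> zE nz_z dP0; have [x ex] := point_of nz_z.
exists x; first by rewrite ex -memvE.
move=> v; rewrite ex => /vlineP[a ->]; split; first by apply: PE; apply: rpredZ.
by move=> j; rewrite (meval_scale _ _ (mderiv_homog j homP)) dP0 mulr0.
Qed.

(* On the line [t |-> e2 + t e1], where [a1 = t] and [a2 = 1], the relations of the normal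
   form read [t q_i = q_(i+1)], so [q_i = t^i q_0]. *)
Lemma normal_form_singular s (M : 'M[K]_(2, N)) :
    normal_form P (sval E) s ->
    (forall z, z \in sval E -> exists a b, z = a *: row 0 M + b *: row 1 M) ->
    (N - \rank (gradients d P M) + nth 0%N s 0 >= N)%N -> (nth 0%N s 0 < d)%N ->
  exists2 x : Gr K n 1, (sval x <= sval E)%VS & singular P x.
Proof.
move=> [N0 [Pi [kerN PiP [/andP[_ s_ge1] sum_s _ basis_s]]]] genM rank_ge lt_d.
have [e1 [e2 [a1 [a2 [ba a11 a12 a21 a22]]]]] := dual_pair (svalP E).
have [w [/andP[_ bw] /andP[_ bL]]] := basis_s a1 a2 ba.
have nz_e1 : vsval e1 != 0.
  apply/eqP => e0; have : e1 = 0 by apply: subvs_inj; rewrite e0.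
  by move=> e; move: a11; rewrite e linear0 => /esym/eqP; rewrite oner_eq0.
have size_w : size w = sumn s.
  have dimW : \dim {: 'rV[K]_N} = N by rewrite dimvf dim_matrix mul1r.
  have := eqP (basis_free bw); rewrite (span_basis bw) dimW size_cat size_tuple sum_s
    => /(congr1 (subn^~ (\dim Pi))).
  by rewrite addKn.
have le_s1 : (sumn s <= nth 0%N s 0)%N.
  rewrite sum_s leq_subLR (leq_trans rank_ge) // leq_add2r.
  exact: dim_Pi kerN PiP genM.
have sing z : z \in sval E -> z != 0 ->
    (forall i, (i < size w)%N -> (contract P w`_i).@[z 0] = 0) ->
    exists2 x : Gr K n 1, (sval x <= sval E)%VS & singular P x.
  move=> zE nz_z w0; apply: (singular_point zE nz_z) => j.
  rewrite -contract_delta; apply: (contract_span (X := vbasis Pi ++ w)); last first.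
    by rewrite (span_basis bw) memvf.
  move=> y; rewrite mem_cat => /orP[yPi|/(nthP 0)[i lt_i <-]]; last exact: w0.
  exact: Pi_contract kerN PiP yPi zE nz_z.
have e1E := subvsP e1; have e2E := subvsP e2.
case: s s_ge1 sum_s basis_s size_w le_s1 lt_d bL rank_ge => [|m s] /=.
  (* Without blocks, [Pi] is the whole space and every point of the line is singular. *)
  by move=> _ _ _ size_w _ _ _ _; apply: (sing _ e1E nz_e1); rewrite size_w.
move=> /andP[m_gt0 s_ge1] _ _ + le_m lt_md bL _.
have s0 : s = [::].
  case: s s_ge1 le_m {bL} => //= k s /andP[k_gt0 _].
  by rewrite -[X in (_ <= X)%N]addn0 leq_add2l leqn0 addn_eq0 -leqn0 leqNgt k_gt0.
move: bL; rewrite s0 /= addn0 => bL size_w.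
have {bL} tL i : (i.+1 < m)%N -> tensor a1 w`_i - tensor a2 w`_i.+1 \in N0.
  move=> lt_i; apply: (basis_mem bL); rewrite mem_cat; apply/orP; right.
  apply/allpairsPdep; exists 0%N, i; split=> //.
  by rewrite mem_iota /= add0n; case: (m) lt_i.
pose q i := line idfun ((vsval e2) 0) ((vsval e1) 0) (contract P w`_i).
have qE i t : (q i).[t] = (contract P w`_i).@[(vsval e2 + t *: vsval e1) 0].
  exact: horner_line_rV.
have qS i : (i.+1 < m)%N -> q i.+1 = 'X * q i.
  move=> lt_i; apply/eqP; rewrite -subr_eq0; apply/eqP.
  apply: (poly_eq0_nz charK) => t _; rewrite hornerD hornerN hornerM hornerX !qE.
  have /kerN/(_ (e2 + t *: e1)) := tL i lt_i.
  rewrite sigmaD -scaleN1r sigmaZ !sigma_tensor.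
  rewrite !linearD !linearZ /= a11 a12 a21 a22 => /eqP.
  rewrite scaler0 add0r addr0 mul1r [t *: _]mulr1 mulN1r subr_eq0 => /eqP ->.
  by rewrite subrr.
have q_pow i : (i < m)%N -> q i = 'X^i * q 0%N.
  elim: i => [|i IH] lt_i; first by rewrite expr0 mul1r.
  by rewrite qS // IH ?(ltnW lt_i) // mulrA -exprS.
(* The first case includes a zero polynomial [q 0]; only nonzero constants are left aside. *)
have [/closed_rootP[t /rootP q0t]|] := boolP (size (q 0%N) != 1%N).
  apply: (sing (vsval (e2 + t *: e1))); first exact: subvsP.
    apply/eqP => e0; have {}e0 : e2 + t *: e1 = 0 by apply: subvs_inj; rewrite e0.
    have := congr1 a2 e0; rewrite linearD linearZ /= a21 a22 scaler0 addr0 linear0.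
    by move/eqP; rewrite oner_eq0.
  move=> i; rewrite size_w => lt_i; rewrite linearD linearZ /= -qE q_pow //.
  by rewrite hornerM q0t mulr0.
(* The common zero is now at infinity, that is at [e1], where the values are the coefficients of
   degree [d - 1] of ['X^i * q 0]. They vanish since [i < m < d] gives [i < d - 1]: the degree
   hypothesis enters here. *)
rewrite negbK => /eqP size_q0.
apply: (sing _ e1E nz_e1) => i; rewrite size_w => lt_i.
have [_ top] := line_homog idfun ((vsval e2) 0) ((vsval e1) 0) (contract_homog homP w`_i).
rewrite /meval -top -/(q i) q_pow // coefXnM; case: ifP => // _.
rewrite nth_default // size_q0 subn_gt0.
by rewrite (leq_trans lt_i) // -ltnS (prednK d_gt0).
Qed.
End NormalForm.

(* [map_resultant], for an arbitrary ring of coefficients. *)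
Lemma resultant_specialization (A R : nzRingType) (f : {rmorphism A -> R}) (p q : {poly A}) :
    f (lead_coef p) != 0 -> f (lead_coef q) != 0 ->
  f (resultant p q) = resultant (map_poly f p) (map_poly f q).
Proof.
move=> fp fq; rewrite -det_map_mx /resultant /Sylvester_mx.
have [-> ->] : size (map_poly f p) = size p /\ size (map_poly f q) = size q.
  by split; apply: size_map_poly_id0.
rewrite map_col_mx; congr (\det (col_mx _ _)); apply: map_lin1_mx => v;
  by rewrite map_poly_rV rmorphM /= map_rVpoly.
Qed.

(** * Openness of the set of lines without singular points *)

Section SmoothLines.
Variables (K : closedFieldType) (charK : [pchar K] =i pred0) (n d : nat).
Local Notation N := n.+1.
Variables (P : {mpoly K[N]}) (homP : P \is d.-homog) (d_gt0 : (0 < d)%N).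

(** On the moment curve with coordinates [t ^+ j], each nonzero [p] excludes only finitely many
    [t]. *)
Lemma avoid_hyperplanes (ps : seq 'rV[K]_N) : (forall p, p \in ps -> p != 0) ->
  exists mu : 'rV[K]_N, forall p, p \in ps -> \sum_j mu 0 j * p 0 j != 0.
Proof.
move=> nz_ps; pose h (p : 'rV[K]_N) := \sum_(j < N) (p 0 j) *: 'X^j.
have nz_h : \prod_(p <- ps) h p != 0.
  rewrite prodf_seq_neq0; apply/allP => p /nz_ps nz_p /=; apply: contraNneq nz_p => h0.
  apply/eqP/rowP => j; have := congr1 (fun q : {poly K} => q`_j) h0.
  rewrite coef0 mxE coef_sum (bigD1 j) //= big1 ?addr0 => [|i /negbTE ij].
    by rewrite coefZ coefXn eqxx mulr1.
  by rewrite coefZ coefXn (inj_eq val_inj) eq_sym ij mulr0.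
have /closed_nonrootP[t ht] := nz_h.
exists (\row_j t ^+ j) => p pps; apply: contra ht => /eqP p0.
rewrite /root horner_prod prodf_seq_eq0; apply/hasP; exists p => //=.
rewrite -p0 /h horner_sum; apply/eqP/eq_bigr => j _.
by rewrite hornerZ hornerXn mxE mulrC.
Qed.

Local Notation X i := (fun j => 'X_(mxvec_index i j) : {mpoly K[(2 * N)%N]}).
Local Notation ev M := (meval (mxvec M 0)).

Lemma map_line_generic (f : {mpoly K[N]}) (M : 'M[K]_(2, N)) :
  map_poly (ev M) (line (@mpolyC (2 * N) K) (X 0) (X 1) f) =
  line idfun (row 0 M 0) (row 1 M 0) f.
Proof.
rewrite map_line; apply: eq_mmap => [c|j] /=; first by rewrite mevalC.
by rewrite !mevalXU !mxvecE !mxE.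
Qed.

(** Nonvanishing at the direction of the line keeps the degree from dropping, as the specialization
    of the resultant requires. *)
Lemma lead_coef_line_generic e (f : {mpoly K[N]}) (M : 'M[K]_(2, N)) :
    f \is e.-homog -> f.@[(row 1 M) 0] != 0 ->
  (ev M) (lead_coef (line (@mpolyC (2 * N) K) (X 0) (X 1) f)) = f.@[(row 1 M) 0].
Proof.
move=> homf nz_f; set l := line _ _ _ _.
have [sz top] := line_homog (@mpolyC (2 * N) K) (X 0) (X 1) homf.
have ev_top : (ev M) l`_e = f.@[(row 1 M) 0].
  rewrite top rmorph_mmap; apply: eq_mmap => [c|j] /=; first exact: mevalC.
  by rewrite mevalXU mxvecE mxE.
rewrite lead_coefE (_ : (size l).-1 = e) //.
suff -> : size l = e.+1 by [].
apply/eqP; rewrite eqn_leq sz ltnNge; apply/negP => /leq_sizeP/(_ e (leqnn e)) l0.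
by move: nz_f; rewrite -ev_top l0 raddf0 eqxx.
Qed.

(* Two partial derivatives, or combinations of them, without common zero on [E0] still
   have none on the lines where their resultant does not vanish. *)
Lemma smooth_line_open (E0 : Gr K n 2) : fano P E0 ->
    (forall x : Gr K n 1, (sval x <= sval E0)%VS -> ~ singular P x) ->
  exists H : {mpoly K[(2 * N)%N]}, ~ vanishes_on mxvec H E0 /\
    forall (E : Gr K n 2) (M : 'M[K]_(2, N)),
      (forall i, row i M \in sval E) -> H.@[mxvec M 0] != 0 ->
      (forall z, z \in sval E -> exists a b, z = a *: row 0 M + b *: row 1 M) /\
      forall x : Gr K n 1, (sval x <= sval E)%VS -> ~ singular P x.
Proof.
move=> PE0 smooth; have [u [v [uE vE ePl free gen]]] := Gr2_basis E0.
have grad z : z \in sval E0 -> z != 0 -> exists j, P^`M(j).@[z 0] != 0.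
  move=> zE nz_z; apply: contrapT => nj.
  have [|x xE] := singular_point homP PE0 zE nz_z; last exact: smooth xE.
  by move=> j; apply: contrapT => /eqP Pj; apply: nj; exists j.
have nz_uv a b : (a, b) != (0, 0) -> a *: u + b *: v != 0.
  by apply: contraNneq => /free[-> ->].
have nz_v : v != 0.
  by have := nz_uv 0 1; rewrite scale0r add0r scale1r; apply; rewrite xpair_eqE oner_eq0 andbF.
have [j1 Q1v] := grad v vE nz_v.
pose Q1 : {mpoly K[N]} := P^`M(j1); pose q1 := line idfun (u 0) (v 0) Q1.
have homQ1 : Q1 \is d.-1.-homog by apply: mderiv_homog.
have [rs q1E] := closed_field_poly_normal q1.
have nz_q1 : q1 != 0.
  apply: contraNneq Q1v => q10; have [_] := line_homog idfun (u 0) (v 0) homQ1.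
  by rewrite -/q1 q10 coef0 => H; apply/eqP/esym.
pose grd (z : 'rV[K]_N) : 'rV[K]_N := \row_j P^`M(j).@[z 0].
have nz_grd z : z \in sval E0 -> z != 0 -> grd z != 0.
  move=> zE /(grad z zE)[j]; apply: contraNneq => /rowP/(_ j).
  by rewrite !mxE => ->.
have nz_ut t : u + t *: v != 0.
  by have := nz_uv 1 t; rewrite scale1r; apply; rewrite xpair_eqE oner_eq0.
(* The second combination of derivatives has to be nonzero at [v] and at the finitely many zeros of
   [Q1] on the rest of the line. *)
have [|mu mu_ok] := @avoid_hyperplanes (grd v :: [seq grd (u + t *: v) | t <- rs]).
  move=> p; rewrite in_cons => /predU1P[->|/mapP[t _ ->]]; first exact: nz_grd.
  by apply: nz_grd => //; rewrite rpredD // rpredZ.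
pose Q2 : {mpoly K[N]} := contract P mu.
have homQ2 : Q2 \is d.-1.-homog by apply: contract_homog.
have Q2E (z : 'rV_N) : Q2.@[z 0] = \sum_j mu 0 j * grd z 0 j.
  by rewrite contractE; apply: eq_bigr => j _; rewrite mxE.
have Q2v : Q2.@[v 0] != 0 by rewrite Q2E mu_ok ?mem_head.
pose q2 := line idfun (u 0) (v 0) Q2.
have coq : coprimep q1 q2.
  apply: Pdiv.ClosedField.root_coprimep => t; rewrite q1E rootZ ?lead_coef_eq0 //.
  rewrite root_prod_XsubC => t_rs; rewrite horner_line_rV Q2E mu_ok // in_cons.
  by apply/orP; right; apply: (map_f (fun t => grd (u + t *: v))) t_rs.
have [i [j nz_ij]] : exists i j, (u^T *m v - v^T *m u) i j != 0.
  apply: contrapT => nij; case/negP: nz_v; apply/eqP.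
  have [a ->] := (mem_pl_mx E0 v).1 vE; rewrite ePl (_ : u^T *m v - v^T *m u = 0) ?mulmx0 //.
  apply/matrixP => i j; rewrite [RHS]mxE.
  by apply/eqP; apply: contrapT => /negP uj; apply: nij; exists i, j.
pose R1 := line (@mpolyC (2 * N) K) (X 0) (X 1) Q1.
pose R2 := line (@mpolyC (2 * N) K) (X 0) (X 1) Q2.
pose minor : {mpoly K[(2 * N)%N]} := X 0 i * X 1 j - X 1 i * X 0 j.
pose top Q := mmap (@mpolyC (2 * N) K) (X 1) Q.
have ev_minor M : (ev M) minor = ((row 0 M)^T *m row 1 M - (row 1 M)^T *m row 0 M) i j.
  rewrite /minor mevalB !mevalM !mevalXU !mxvecE !mxE !big_ord_recl !big_ord0 !mxE !addr0.
  by [].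
have ev_top M Q : (ev M) (top Q) = Q.@[(row 1 M) 0].
  rewrite rmorph_mmap; apply: eq_mmap => [c|k] /=; first exact: mevalC.
  by rewrite mevalXU mxvecE mxE.
have ev_res M : Q1.@[(row 1 M) 0] != 0 -> Q2.@[(row 1 M) 0] != 0 ->
    (ev M) (resultant R1 R2) = resultant (line idfun (row 0 M 0) (row 1 M 0) Q1)
                                         (line idfun (row 0 M 0) (row 1 M 0) Q2).
  move=> Q1M Q2M; rewrite -!map_line_generic; apply: resultant_specialization.
    by rewrite [Y in Y != 0](lead_coef_line_generic homQ1).
  by rewrite [Y in Y != 0](lead_coef_line_generic homQ2).
(* The minor makes the two rows span the line, the two values at row 1 keep the degrees and exclude
   a common zero there, and the resultant excludes the other common zeros. *)
exists (minor * top Q1 * top Q2 * resultant R1 R2); split.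
  pose M0 : 'M[K]_(2, N) := \matrix_(i < 2) (if i == 0 then u else v).
  move=> /(_ M0); have r0 : row 0 M0 = u by rewrite rowK.
  have r1 : row 1 M0 = v by rewrite rowK.
  have M0E k : row k M0 \in sval E0 by rewrite rowK; case: ifP.
  move=> /(_ M0E)/eqP; rewrite !mevalM !mulf_eq0 ev_minor !ev_top r0 r1.
  rewrite (negbTE nz_ij) (negbTE Q1v) (negbTE Q2v) ev_res ?r0 ?r1 //.
  by rewrite resultant_eq0 ltnNge -/q1 -/q2 (eqP coq).
move=> E M ME; rewrite !mevalM !mulf_eq0 !negb_or ev_minor !ev_top.
move=> /andP[/andP[/andP[nz_minor Q1M] Q2M]]; rewrite ev_res // resultant_eq0 -leqNgt.
set p1 := line _ _ _ _; set p2 := line _ _ _ _ => co_p.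
have genM z : z \in sval E -> exists a b, z = a *: row 0 M + b *: row 1 M.
  move=> zE; have [a ea] := wedge_mx (ME 0) (ME 1).
  have nz_a : a != 0.
    by apply: contraNneq nz_minor => a0; rewrite ea a0 scale0r mxE.
  have [c ->] := (mem_pl_mx E z).1 zE.
  have -> : pl_mx E = a^-1 *: ((row 0 M)^T *m row 1 M - (row 1 M)^T *m row 0 M).
    by rewrite ea scalerA mulVf // scale1r.
  rewrite -scalemxAr mul_wedge scalerBr !scalerA addrC -scaleNr.
  by eexists; eexists.
split=> // x xE singx.
have zx := mem_proj_coord x; have nz_z := proj_coord_neq0 x.
move: (proj_coord x) zx nz_z => z zx nz_z; have [Pz dPz] := singx z zx.
have Q1z : Q1.@[z 0] = 0 by apply: dPz.
have Q2z : Q2.@[z 0] = 0 by rewrite contractE big1 // => k _; rewrite dPz mulr0.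
have [a [b ez]] := genM z (subvP xE z zx).
have [a0|nz_a] := eqVneq a 0.
  have nz_b : b != 0 by apply: contraNneq nz_z => b0; rewrite ez a0 b0 !scale0r addr0.
  move: Q1z; rewrite ez a0 scale0r add0r (meval_scale _ _ homQ1) => /eqP.
  by rewrite mulf_eq0 expf_eq0 (negbTE nz_b) andbF (negbTE Q1M).
have root_p Q : Q \is d.-1.-homog -> Q.@[z 0] = 0 ->
    (line idfun (row 0 M 0) (row 1 M 0) Q).[b / a] = 0.
  move=> homQ Qz; rewrite horner_line_rV.
  have -> : row 0 M + (b / a) *: row 1 M = a^-1 *: z.
    by rewrite ez scalerDr !scalerA mulVf // scale1r mulrC.
  by rewrite (meval_scale _ _ homQ) Qz mulr0.
have cop : coprimep p1 p2.
  rewrite /coprimep eqn_leq co_p size_poly_gt0 gcdp_eq0 negb_and.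
  apply/orP; left; apply: contraNneq Q1M => p10.
  have [_] := line_homog idfun (row 0 M 0) (row 1 M 0) homQ1.
  by rewrite -/p1 p10 coef0 => H; apply/eqP/esym.
have := coprimep_root cop (introT rootP (root_p _ homQ1 Q1z)).
by rewrite (root_p _ homQ2 Q2z) eqxx.
Qed.
End SmoothLines.

Theorem theorem3p2 (K : closedFieldType) (charK : [pchar K] =i pred0)
    (n d : nat) (P : {mpoly K[n.+1]}) (P_neq0 : P != 0) (P_homog : P \is d.-homog)
    (B : Gr K n 2 -> Prop)
    (B_comp : irreducible_component (@closedG K n) (fano P) B)
    (b : nat) (dimB : has_dim (@closedG K n) B b) (b_ge : (n <= b + 2)%N)
    (s : seq nat)
    (s_gen : generically (@closedG K n) B
               (fun E => normal_form P (sval E) s))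
    (c : nat)
    (c_gen : generically (@closedP K n) (swept B)
               (fun x => has_dim (@closedG K n) (lines_through B x) c))
    (deg_ge : (nth 0 s 0 + 1 <= d)%N)
    (s1_eq : (nth 0 s 0 + c + 1 = n)%N) :
  forall E : Gr K n 2, B E ->
    exists2 x : Gr K n 1, (sval x <= sval E)%VS & singular P x.

Proof.
have d_gt0 : (0 < d)%N by apply: leq_trans deg_ge; rewrite addn1.
have [[clB irrB] BP _] := B_comp.
move=> E0 BE0; apply: contrapT => smooth.
have [|H [nz_H genH]] := smooth_line_open P_homog (BP E0 BE0).
  by move=> x xE singx; apply: smooth; exists x.
have [Z [_ [_ dense] nfZ]] := s_gen.
(* If [H] vanished on all lines of [B] outside [Z], then by density it would vanish on [E0] too,
   vanishing being a closed condition. *)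
have [E [BE nZE nHE]] : exists E, [/\ B E, ~ Z E & ~ vanishes_on mxvec H E].
  apply: contrapT => nE; apply: nz_H; apply: dense BE0; first exact: vanishes_on_closed.
  by move=> E [BE nZE]; apply: contrapT => nHE; apply: nE; exists E.
have [M [ME HM]] : exists M, (forall i, row i M \in sval E) /\ H.@[mxvec M 0] != 0.
  apply: contrapT => nM; apply: nHE => M ME.
  by apply: contrapT => /eqP HM; apply: nM; exists M.
have [genM smoothE] := genH E M ME HM.
have c_chain : generically (@closedP K n) (swept B)
    (fun x => has_chain (@closedG K n) (lines_through B x) c).
  have [Y [clY denseY dimY]] := c_gen.
  by exists Y; split=> // x Bx nYx; have [] := dimY x Bx nYx.
have rankM := fibre_dimension charK d irrB BP c_chain BE ME.
have [||x xE singx] := normal_form_singular charK P_homog d_gt0 (BP E BE) (nfZ E BE nZE) genM.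
(* Since [n + 1 = s_1 + c + 2], the bound on the fibre says that the rank is at most [s_1]. *)
- have le_rank : (\rank (gradients d P M) <= nth 0%N s 0)%N.
    move: rankM; move: (\rank _) => r.
    by rewrite -s1_eq addn1 -2!addnS addnC leq_add2r.
  by rewrite -{1}(subnK (leq_trans (leq_addl _ _) rankM)) leq_add2l.
- by rewrite -addn1.
exact: smoothE singx.
Qed.
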